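(* Let $\Delta$ be a nonempty finite graph and let $\Gamma=\Delta*K_2$ be the join of $\Delta$ with the complete graph on two vertices. Then $\Gamma$ is biconnected and $H_\Gamma\cong A_\Delta\times\mathbb Z$. In particular, $H_\Gamma$ is a right-angled Artin group of type $F$. There are injective homomorphisms $$\mathrm{Aut}(A_\Delta)\hookrightarrow\mathrm{Aut}(H_\Gamma),\qquad \mathrm{Out}(A_\Delta)\hookrightarrow\mathrm{Out}(H_\Gamma).$$ Moreover, $\mathrm{IAut}(H_\Gamma)\cong\mathrm{IAut}(A_\Delta)$.
   Context: All graphs are finite and simple. For a graph $\Gamma$, $A_\Gamma=\langle V(\Gamma)\mid [u,v]=1 \text{ whenever } uv\in E(\Gamma)\rangle$ is the right-angled Artin group, $\chi_\Gamma:A_\Gamma\to\mathbb Z$ is the character with $\chi_\Gamma(v)=1$ for every vertex $v$, and the Bestvina--Brady group is $H_\Gamma=\ker\chi_\Gamma$. The join $\Gamma_1*\Gamma_2$ is the disjoint union with all edges between $V(\Gamma_1)$ and $V(\Gamma_2)$ added. A connected graph with at least three vertices is biconnected if deleting any one vertex leaves it connected. For a group $G$, $\mathrm{IAut}(G)=\ker(\mathrm{Aut}(G)\to\mathrm{GL}(H_1(G;\mathbb Z)))$. A group is of type $F$ if it has a finite classifying space. *)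

(* Defs.v *)
From HB Require Import structures.
From mathcomp Require Import all_boot all_order all_algebra.
From mathcomp Require Import generic_quotient.
From mathcomp Require Import all_classical all_reals all_analysis.
Import numFieldNormedType.Exports.
Import Order.TTheory GRing.Theory Num.Theory.

Set Implicit Arguments.
Unset Strict Implicit.
Unset Printing Implicit Defensive.

Local Open Scope group_scope.

Record sgraph := SGraph {
  vertex :> finType;
  adj : rel vertex;
  adj_sym : symmetric adj;
  adj_irrefl : irreflexive adj }.

Section Graphs.
Implicit Types G D : sgraph.

Definition join_adj G D : rel (G + D) := fun x y =>
  match x, y with
  | inl u, inl v => adj u v
  | inr u, inr v => adj u v
  | _, _ => true
  end.

Lemma join_adj_sym G D : symmetric (@join_adj G D).
Proof. by case=> x [] y //=; rewrite adj_sym. Qed.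

Lemma join_adj_irrefl G D : irreflexive (@join_adj G D).
Proof. by case=> x /=; rewrite adj_irrefl. Qed.

Definition graph_join G D := SGraph (@join_adj_sym G D) (@join_adj_irrefl G D).

Definition complete_adj n : rel 'I_n := fun i j => i != j.

Lemma complete_adj_sym n : symmetric (@complete_adj n).
Proof. by move=> i j; rewrite /complete_adj eq_sym. Qed.

Lemma complete_adj_irrefl n : irreflexive (@complete_adj n).
Proof. by move=> i; rewrite /complete_adj eqxx. Qed.

Definition complete_graph n := SGraph (@complete_adj_sym n) (@complete_adj_irrefl n).

Definition induced_adj G (P : pred G) : rel {x : G | P x} :=
  fun x y => adj (val x) (val y).

Lemma induced_adj_sym G (P : pred G) : symmetric (@induced_adj G P).
Proof. by move=> x y; rewrite /induced_adj adj_sym. Qed.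

Lemma induced_adj_irrefl G (P : pred G) : irreflexive (@induced_adj G P).
Proof. by move=> x; rewrite /induced_adj adj_irrefl. Qed.

Definition induced G (P : pred G) :=
  SGraph (@induced_adj_sym G P) (@induced_adj_irrefl G P).

Definition connected_graph G : Prop :=
  (0 < #|G|)%N /\ forall x y : G, connect (@adj G) x y.

Definition biconnected G : Prop :=
  [/\ (3 <= #|G|)%N, connected_graph G &
      forall v : G, connected_graph (induced (predC1 v))].

End Graphs.

Definition isomorphic (G H : groupType) : Prop :=
  exists f : {multiplicative G -> H}, bijective f.

Section Kernel.
Variables (G H : groupType) (f : {multiplicative G -> H}).

Lemma morph1 : f 1 = 1.
Proof. by apply: (@mulgI _ (f 1)); rewrite -gmulfM !mulg1. Qed.

Lemma morphV x : f x^-1 = (f x)^-1.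
Proof. by apply: (@mulgI _ (f x)); rewrite -gmulfM !mulgV morph1. Qed.

Definition ker_pred : pred G := fun x => f x == 1.

Lemma ker_group_closed : group_closed ker_pred.
Proof.
split; first by rewrite unfold_in /ker_pred morph1.
move=> x y; rewrite !unfold_in /ker_pred gmulfM morphV.
by move=> /eqP-> /eqP->; rewrite divgg.
Qed.

Definition kernel := {x : G | ker_pred x}.

HB.instance Definition _ := [isSub of kernel for @sval G ker_pred].
HB.instance Definition _ := [Choice of kernel by <:].
HB.instance Definition _ :=
  SubChoice_isSubGroup.Build G ker_pred kernel ker_group_closed.

End Kernel.

Record normal_subgroup (G : groupType) := NormalSubgroup {
  nsub :> G -> Prop;
  nsub1 : nsub 1;
  nsubM : forall x y, nsub x -> nsub y -> nsub (x * y);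
  nsubV : forall x, nsub x -> nsub x^-1;
  nsubJ : forall x y, nsub x -> nsub (x ^ y) }.

Section Quotient.
Variables (G : groupType) (N : normal_subgroup G).

Definition coset_rel : rel G := fun x y => `[< N (x^-1 * y) >].

Lemma coset_rel_refl : reflexive coset_rel.
Proof. by move=> x; apply/asboolP; rewrite mulVg; apply: nsub1. Qed.

Lemma coset_rel_sym : symmetric coset_rel.
Proof.
have sub x y : coset_rel x y -> coset_rel y x.
  move=> /asboolP/(@nsubV _ N) xy; apply/asboolP.
  by rewrite invgM invgK in xy.
by move=> x y; apply/idP/idP; apply: sub.
Qed.

Lemma coset_rel_trans : transitive coset_rel.
Proof.
move=> y x z /asboolP xy /asboolP yz; apply/asboolP.
by have := nsubM xy yz; rewrite mulgA mulgK.
Qed.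

Canonical coset_equiv :=
  EquivRel coset_rel coset_rel_refl coset_rel_sym coset_rel_trans.

Definition quotient_group := {eq_quot coset_equiv}%qT.
HB.instance Definition _ := Choice.on quotient_group.
HB.instance Definition _ := EqQuotient.on quotient_group.

Definition qproj (x : G) : quotient_group := (\pi_quotient_group x)%qT.

Lemma qproj_eq x y : qproj x = qproj y <-> N (x^-1 * y).
Proof.
split; first by move/eqquotP/asboolP.
by move=> xy; apply/eqquotP/asboolP.
Qed.

Lemma qproj_repr (a : quotient_group) : qproj (repr a) = a.
Proof. exact: reprK. Qed.

Definition quot_one := qproj 1.
Definition quot_mul (a b : quotient_group) := qproj (repr a * repr b).
Definition quot_inv (a : quotient_group) := qproj (repr a)^-1.

Lemma quot_mulE x y : quot_mul (qproj x) (qproj y) = qproj (x * y).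
Proof.
have xN : N ((repr (qproj x))^-1 * x) by apply/qproj_eq; rewrite qproj_repr.
have yN : N ((repr (qproj y))^-1 * y) by apply/qproj_eq; rewrite qproj_repr.
apply/qproj_eq; move: (repr _) (repr _) xN yN => x' y' xN yN.
have := nsubM yN (nsubJ y xN).
by rewrite conjgE invgM !mulgA mulgK.
Qed.

Lemma quot_invE x : quot_inv (qproj x) = qproj x^-1.
Proof.
have xN : N ((repr (qproj x))^-1 * x) by apply/qproj_eq; rewrite qproj_repr.
apply/qproj_eq; move: (repr _) xN => x' xN.
have := nsubV (nsubJ x^-1 xN).
by rewrite conjgE !invgM !invgK mulgA mulgV mul1g.
Qed.

Lemma quot_mulA : associative quot_mul.
Proof.
move=> a b c; rewrite -(qproj_repr a) -(qproj_repr b) -(qproj_repr c).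
by rewrite !quot_mulE mulgA.
Qed.

Lemma quot_mul1 : left_id quot_one quot_mul.
Proof. by move=> a; rewrite -(qproj_repr a) quot_mulE mul1g. Qed.

Lemma quot_1mul : right_id quot_one quot_mul.
Proof. by move=> a; rewrite -(qproj_repr a) quot_mulE mulg1. Qed.

Lemma quot_mulV : left_inverse quot_one quot_inv quot_mul.
Proof. by move=> a; rewrite -(qproj_repr a) quot_invE quot_mulE mulVg. Qed.

Lemma quot_Vmul : right_inverse quot_one quot_inv quot_mul.
Proof. by move=> a; rewrite -(qproj_repr a) quot_invE quot_mulE mulgV. Qed.

HB.instance Definition _ := isGroup.Build quotient_group
  quot_mulA quot_mul1 quot_1mul quot_mulV quot_Vmul.

Lemma qprojM : {morph qproj : x y / x * y}.
Proof. by move=> x y; rewrite -quot_mulE. Qed.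

HB.instance Definition _ := isMultiplicative.Build G quotient_group qproj qprojM.

End Quotient.

(* The inverse is stored in the record; it is determined by the function (autP). *)
Record Aut (G : groupType) := MkAut {
  aut_fun :> G -> G;
  aut_inv : G -> G;
  autM : {morph aut_fun : x y / x * y};
  aut_funK : cancel aut_fun aut_inv;
  aut_invK : cancel aut_inv aut_fun }.

Section Aut.
Variable G : groupType.
Implicit Types f g h : Aut G.

Lemma autP f g : f =1 g -> f = g.
Proof.
case: f g => f f' fM fK f'K [g g' gM gK g'K] /= /funext fg; subst g.
have f'g' : f' = g' by apply/funext => x; rewrite -{1}(g'K x) fK.
subst g'.
by congr MkAut; apply: Prop_irrelevance.
Qed.

Lemma aut_inv_morph f : {morph aut_inv f : x y / x * y}.
Proof.
move=> x y; apply: (can_inj (aut_funK f)).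
by rewrite autM !aut_invK.
Qed.

Lemma aut_comp_morph f g : {morph f \o g : x y / x * y}.
Proof. by move=> x y /=; rewrite !autM. Qed.

Definition aut_one : Aut G :=
  @MkAut G idfun idfun (fun x y => erefl) (fun x => erefl) (fun x => erefl).

Definition aut_mul f g : Aut G := MkAut (aut_comp_morph f g)
  (can_comp (aut_funK f) (aut_funK g)) (can_comp (aut_invK g) (aut_invK f)).

Definition aut_inverse f : Aut G :=
  MkAut (aut_inv_morph f) (aut_invK f) (aut_funK f).

HB.instance Definition _ := gen_eqMixin (Aut G).
HB.instance Definition _ := gen_choiceMixin (Aut G).

Lemma aut_mulA : associative aut_mul.
Proof. by move=> f g h; apply: autP. Qed.

Lemma aut_mul1 : left_id aut_one aut_mul.
Proof. by move=> f; apply: autP. Qed.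

Lemma aut_1mul : right_id aut_one aut_mul.
Proof. by move=> f; apply: autP. Qed.

Lemma aut_mulV : left_inverse aut_one aut_inverse aut_mul.
Proof. by move=> f; apply: autP => x /=; rewrite aut_funK. Qed.

Lemma aut_Vmul : right_inverse aut_one aut_inverse aut_mul.
Proof. by move=> f; apply: autP => x /=; rewrite aut_invK. Qed.

HB.instance Definition _ := isGroup.Build (Aut G)
  aut_mulA aut_mul1 aut_1mul aut_mulV aut_Vmul.

HB.instance Definition _ f := isMultiplicative.Build G G (aut_fun f) (autM f).

Definition is_inner f : Prop := exists g : G, forall x, f x = g * x * g^-1.

Lemma inner1 : is_inner 1.
Proof. by exists 1 => x; rewrite invg1 mulg1 mul1g. Qed.

Lemma innerM f g : is_inner f -> is_inner g -> is_inner (f * g).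
Proof.
move=> [a fa] [b gb]; exists (a * b) => x.
by rewrite [LHS]fa gb invgM !mulgA.
Qed.

Lemma innerV f : is_inner f -> is_inner f^-1.
Proof.
move=> [a fa]; exists a^-1 => x; apply: (can_inj (aut_funK f)).
by rewrite [LHS]aut_invK fa invgK !mulgA mulgV mul1g mulgK.
Qed.

Lemma innerJ f g : is_inner f -> is_inner (f ^ g).
Proof.
move=> [a fa]; exists (aut_inv g a) => x.
rewrite [LHS](_ : _ = aut_inv g (f (g x))) // fa; apply: (can_inj (aut_funK g)).
rewrite [LHS]aut_invK !autM (morphV g) aut_invK; congr (_ * _^-1).
by rewrite [RHS]aut_invK.
Qed.

Definition Inn := NormalSubgroup inner1 innerM innerV innerJ.

Definition Out := quotient_group Inn.
HB.instance Definition _ := Group.on Out.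

End Aut.

Section Homology.
Variable G : groupType.

Inductive derived : G -> Prop :=
| derived_comm x y : derived [~ x, y]
| derived_1 : derived 1
| derived_mul x y : derived x -> derived y -> derived (x * y)
| derived_inv x : derived x -> derived x^-1.

Lemma derivedJ x y : derived x -> derived (x ^ y).
Proof.
move=> dx; have := derived_mul dx (derived_comm x y).
by rewrite commgEl mulgA mulgV mul1g.
Qed.

Definition commutator_subgroup :=
  NormalSubgroup derived_1 derived_mul derived_inv derivedJ.

(* H_1(G; Z) is the abelianization of G, written multiplicatively. *)
Definition H1 := quotient_group commutator_subgroup.
HB.instance Definition _ := Group.on H1.

Definition H1_proj : G -> H1 := @qproj G commutator_subgroup.

Lemma derived_aut (f : Aut G) x : derived x -> derived (f x).
Proof.
elim=> [a b||a b _ da _ db|a _ da].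
- by rewrite /commg !gmulfM !morphV; apply: derived_comm.
- by rewrite morph1; apply: derived_1.
- by rewrite gmulfM; apply: derived_mul.
- by rewrite morphV; apply: derived_inv.
Qed.

Definition H1_fun (f : Aut G) (a : H1) : H1 := H1_proj (f (repr a)).

Lemma H1_funE f x : H1_fun f (H1_proj x) = H1_proj (f x).
Proof.
apply/qproj_eq; rewrite -morphV -gmulfM; apply: derived_aut.
by apply/(qproj_eq commutator_subgroup); rewrite qproj_repr.
Qed.

Lemma H1_projP (a : H1) : exists x, a = H1_proj x.
Proof. by exists (repr a); rewrite [RHS]qproj_repr. Qed.

Lemma H1_funM f : {morph H1_fun f : a b / a * b}.
Proof.
move=> a b; have [x ->] := H1_projP a; have [y ->] := H1_projP b.
by rewrite -[_ * _](qprojM commutator_subgroup) !H1_funE autM [LHS]qprojM.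
Qed.

Lemma H1_funK f : cancel (H1_fun f) (H1_fun f^-1).
Proof.
move=> a; have [x ->] := H1_projP a.
by rewrite !H1_funE; congr H1_proj; apply: aut_funK.
Qed.

Lemma H1_funVK f : cancel (H1_fun f^-1) (H1_fun f).
Proof.
move=> a; have [x ->] := H1_projP a.
by rewrite !H1_funE; congr H1_proj; apply: aut_invK.
Qed.

Definition H1_aut f : Aut H1 := MkAut (H1_funM f) (H1_funK f) (H1_funVK f).

Lemma H1_autM : {morph H1_aut : f g / f * g}.
Proof.
move=> f g; apply: autP => a; have [x ->] := H1_projP a.
by rewrite /= !H1_funE.
Qed.

HB.instance Definition _ := isMultiplicative.Build (Aut G) (Aut H1) H1_aut H1_autM.

(* GL(H_1(G; Z)) is the group of automorphisms of the abelian group H_1. *)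
Definition IAut := kernel H1_aut.
HB.instance Definition _ := Group.on IAut.

End Homology.

(* Group presentations: the letter (x, true) stands for x, (x, false) for its
   inverse, and R u v for the relation u = v. *)
Section Presentation.
Variables (X : choiceType) (R : seq (X * bool) -> seq (X * bool) -> Prop).

Inductive pres_eq : seq (X * bool) -> seq (X * bool) -> Prop :=
| pres_refl u : pres_eq u u
| pres_sym u v : pres_eq u v -> pres_eq v u
| pres_trans v u w : pres_eq u v -> pres_eq v w -> pres_eq u w
| pres_cat u u' v v' :
    pres_eq u u' -> pres_eq v v' -> pres_eq (u ++ v) (u' ++ v')
| pres_cancel x b : pres_eq [:: (x, b); (x, ~~ b)] [::]
| pres_relator u v : R u v -> pres_eq u v.

Definition pres_rel : rel (seq (X * bool)) := fun u v => `[< pres_eq u v >].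

Lemma pres_rel_refl : reflexive pres_rel.
Proof. by move=> u; apply/asboolP; apply: pres_refl. Qed.

Lemma pres_rel_sym : symmetric pres_rel.
Proof. by move=> u v; apply/asboolP/asboolP; apply: pres_sym. Qed.

Lemma pres_rel_trans : transitive pres_rel.
Proof.
by move=> v u w /asboolP uv /asboolP vw; apply/asboolP; apply: pres_trans vw.
Qed.

Canonical pres_equiv :=
  EquivRel pres_rel pres_rel_refl pres_rel_sym pres_rel_trans.

Definition presented := {eq_quot pres_equiv}%qT.
HB.instance Definition _ := Choice.on presented.
HB.instance Definition _ := EqQuotient.on presented.

Definition pres_class (u : seq (X * bool)) : presented := (\pi_presented u)%qT.

Lemma pres_class_eq u v : pres_class u = pres_class v <-> pres_eq u v.
Proof.
split; first by move/eqquotP/asboolP.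
by move=> uv; apply/eqquotP/asboolP.
Qed.

Lemma pres_class_repr (a : presented) : pres_class (repr a) = a.
Proof. exact: reprK. Qed.

Definition word_inv (u : seq (X * bool)) := rev [seq (l.1, ~~ l.2) | l <- u].

Lemma word_inv_cat u v : word_inv (u ++ v) = word_inv v ++ word_inv u.
Proof. by rewrite /word_inv map_cat rev_cat. Qed.

Lemma word_invK : involutive word_inv.
Proof.
move=> u; rewrite /word_inv map_rev revK -map_comp -[RHS]map_id.
by apply: eq_map => -[x b] /=; rewrite negbK.
Qed.

Lemma word_mulV u : pres_eq (u ++ word_inv u) [::].
Proof.
elim/last_ind: u => [|u [x b] IHu]; first exact: pres_refl.
rewrite -cats1 word_inv_cat -catA; apply: pres_trans IHu.
apply: pres_cat; first exact: pres_refl.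
exact: (pres_cat (pres_cancel x b) (pres_refl (word_inv u))).
Qed.

Lemma word_Vmul u : pres_eq (word_inv u ++ u) [::].
Proof. by rewrite -{2}(word_invK u); apply: word_mulV. Qed.

Definition pres_one := pres_class [::].
Definition pres_mul (a b : presented) := pres_class (repr a ++ repr b).
Definition pres_inv (a : presented) := pres_class (word_inv (repr a)).

Lemma pres_mulE u v :
  pres_mul (pres_class u) (pres_class v) = pres_class (u ++ v).
Proof.
by apply/pres_class_eq/pres_cat; apply/pres_class_eq; rewrite pres_class_repr.
Qed.

Lemma pres_mulA : associative pres_mul.
Proof.
move=> a b c; rewrite -(pres_class_repr a) -(pres_class_repr b).
by rewrite -(pres_class_repr c) !pres_mulE catA.
Qed.

Lemma pres_mul1 : left_id pres_one pres_mul.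
Proof. by move=> a; rewrite -(pres_class_repr a) pres_mulE. Qed.

Lemma pres_1mul : right_id pres_one pres_mul.
Proof. by move=> a; rewrite -(pres_class_repr a) pres_mulE cats0. Qed.

Lemma pres_mulV : left_inverse pres_one pres_inv pres_mul.
Proof.
move=> a; rewrite -{2}(pres_class_repr a) pres_mulE.
by apply/pres_class_eq/word_Vmul.
Qed.

Lemma pres_Vmul : right_inverse pres_one pres_inv pres_mul.
Proof.
move=> a; rewrite -{1}(pres_class_repr a) pres_mulE.
by apply/pres_class_eq/word_mulV.
Qed.

HB.instance Definition _ := isGroup.Build presented
  pres_mulA pres_mul1 pres_1mul pres_mulV pres_Vmul.

Definition pres_gen (x : X) : presented := pres_class [:: (x, true)].

Section Lift.
Variables (H : groupType) (f : X -> H).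

Definition word_eval (u : seq (X * bool)) : H :=
  \prod_(l <- u) (if l.2 then f l.1 else (f l.1)^-1).

Hypothesis fR : forall u v, R u v -> word_eval u = word_eval v.

Lemma word_eval_pres u v : pres_eq u v -> word_eval u = word_eval v.
Proof.
elim=> //.
- by move=> ? ? ? _ -> _ ->.
- by move=> ? ? ? ? _ uu' _ vv'; move: uu' vv'; rewrite /word_eval !big_cat /= => -> ->.
- move=> x b; rewrite /word_eval !big_cons big_nil /=.
  by case: b; rewrite mulg1 ?mulgV ?mulVg.
Qed.

Definition pres_lift (a : presented) : H := word_eval (repr a).

Lemma pres_lift_class u : pres_lift (pres_class u) = word_eval u.
Proof. by apply/word_eval_pres/pres_class_eq; rewrite pres_class_repr. Qed.

Lemma pres_lift_gen x : pres_lift (pres_gen x) = f x.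
Proof. by rewrite pres_lift_class /word_eval big_seq1. Qed.

Lemma pres_liftM : {morph pres_lift : a b / a * b}.
Proof.
move=> a b; rewrite -(pres_class_repr a) -(pres_class_repr b).
by rewrite [_ * _]pres_mulE !pres_lift_class /word_eval big_cat.
Qed.

End Lift.
End Presentation.

Definition Z_group := Algebra.to_multiplicative int.
HB.instance Definition _ := Group.on Z_group.

Section RAAG.
Variable Gamma : sgraph.

Inductive raag_relation : seq (Gamma * bool) -> seq (Gamma * bool) -> Prop :=
| raag_commute u v : adj u v ->
    raag_relation [:: (u, true); (v, true)] [:: (v, true); (u, true)].

Definition raag := presented raag_relation.
HB.instance Definition _ := Group.on raag.

Definition raag_gen (v : Gamma) : raag := pres_gen raag_relation v.

Definition chi : raag -> Z_group :=
  @pres_lift _ raag_relation Z_group (fun=> 1%:Z%R).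

Lemma chi_relation u v : raag_relation u v ->
  @word_eval _ Z_group (fun=> 1%:Z%R) u = @word_eval _ Z_group (fun=> 1%:Z%R) v.
Proof. by case=> x y _; rewrite /word_eval !big_cons. Qed.

Lemma chi_gen v : chi (raag_gen v) = 1%:Z%R.
Proof. exact: (pres_lift_gen chi_relation). Qed.

Lemma chiM : {morph chi : a b / a * b}.
Proof. exact: (pres_liftM chi_relation). Qed.

HB.instance Definition _ := isMultiplicative.Build raag Z_group chi chiM.

Definition bestvina_brady := kernel chi.
HB.instance Definition _ := Group.on bestvina_brady.

End RAAG.

Definition is_raag (G : groupType) : Prop :=
  exists Gamma : sgraph, isomorphic G (raag Gamma).

Section TypeF.
Variable R : realType.
Local Open Scope classical_set_scope.
Local Open Scope ring_scope.

(* The norm on 'rV[R]_n is the sup norm, so the closed unit ball is the cube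
   [-1, 1]^n, a model of the closed n-disc (a point for n = 0).  The values of
   cw_map outside the closed ball are irrelevant.  For finitely many cells in a
   Hausdorff space, closure-finiteness, the weak topology and the fact that
   cw_map is a homeomorphism from the open ball onto the open cell are
   automatic. *)
Record finite_CW (X : topologicalType) := FiniteCW {
  cw_cell : finType;
  cw_dim : cw_cell -> nat;
  cw_map : forall c : cw_cell, 'rV[R]_(cw_dim c) -> X;
  cw_hausdorff : hausdorff_space X;
  cw_map_continuous : forall c,
    {within [set v : 'rV[R]_(cw_dim c) | `|v| <= 1], continuous (@cw_map c)};
  cw_map_inj : forall c (v w : 'rV[R]_(cw_dim c)),
    `|v| < 1 -> `|w| < 1 -> cw_map v = cw_map w -> v = w;
  cw_disjoint : forall c d (v : 'rV[R]_(cw_dim c)) (w : 'rV[R]_(cw_dim d)),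
    `|v| < 1 -> `|w| < 1 -> cw_map v = cw_map w -> c = d;
  cw_cover : forall x : X,
    exists c, exists2 v : 'rV[R]_(cw_dim c), `|v| < 1 & cw_map v = x;
  cw_boundary : forall c (v : 'rV[R]_(cw_dim c)), `|v| = 1 ->
    exists2 d, (cw_dim d < cw_dim c)%N &
      exists2 w : 'rV[R]_(cw_dim d), `|w| < 1 & cw_map w = cw_map v }.

Definition contractible (X : topologicalType) : Prop :=
  exists (x0 : X) (h : X * R -> X),
    [/\ {within [set p : X * R | 0 <= p.2 <= 1], continuous h},
        forall x, h (x, 0) = x & forall x, h (x, 1) = x0].

(* B is the base of a principal G-bundle with contractible total space E, for
   G discrete: p is the quotient map of a covering space action of G on E. *)
Definition classifying_space (G : groupType) (B : topologicalType) : Prop :=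
  exists (E : topologicalType) (act : G -> E -> E) (p : E -> B),
  [/\ contractible E,
      [/\ act 1%g =1 id, forall g h e, act (g * h)%g e = act g (act h e) &
          forall g, continuous (act g)],
      forall e : E, exists U : set E, [/\ open U, U e &
        forall g, U `&` act g @` U !=set0 -> g = 1%g],
      [/\ forall b, exists e, p e = b &
          forall e e', p e = p e' <-> exists g, act g e = e'] &
      forall U : set B, open U <-> open (p @^-1` U)].

Definition type_F (G : groupType) : Prop :=
  exists B : topologicalType, inhabited (finite_CW B) /\ classifying_space G B.

End TypeF.

(* Main.v *)
From HB Require Import structures.
Require Import Defs.
From mathcomp Require Import all_boot all_algebra.
From mathcomp Require Import reals.
From mathcomp Require Import all_order all_classical all_analysis.
From mathcomp Require Import ring lra.
Import numFieldNormedType.Exports.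
Import Order.TTheory GRing.Theory Num.Theory.

(*
Let x be one of the two cone vertices of Gamma.  Sending every other generator g to
g / x identifies the raag of the cone over Delta, that is A_Delta x Z, with H_Gamma.

Let A be a raag.  An element of A, or more generally a point of the universal
cover of the Salvetti complex, is a heap of pieces, the last ones of which may
have fractional length.  Letting the pieces fall down yields a function
y : nat -> V -> R, where y k v is the signed length of the piece v in layer k
(Foata normal form).  These functions, with the product topology, form a
contractible space, since all heaps can be truncated at a height that decreases
to 0.  Appending letters gives an action on integral heaps (van der Waerden's
argument), so integral heaps are in bijection with A, and general heaps with
A x S, where S is the set of points of the torus (R/Z)^V with clique support.
Left multiplication on A x S is continuous, because the heaps at distance less
than 1 from an integral heap m are obtained by appending to m powers of commuting
generators with exponents in ]-1, 1[, and it is a covering action with quotient S.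

For IAut, the point is that a central element c of A in [A, A] is trivial.  If v
is the letter of a piece in the last layer of the heap of c, comparing the heaps of
c v^n and v^n c for n large shows that c has a nonzero exponent sum in v.  So an
automorphism of A x Z that is trivial on homology is determined by one of A.
*)

Set Implicit Arguments.
Unset Strict Implicit.
Unset Printing Implicit Defensive.

Local Open Scope ring_scope.

(** * Heaps of pieces *)

Section Tetris.
Variables (R : realType) (V : sgraph).
Implicit Types (y m : nat -> V -> R) (u v w : V) (b : bool) (k j : nat).

Definition noncomm u v := ~~ adj u v.

Lemma noncomm_refl v : noncomm v v.
Proof. by rewrite /noncomm adj_irrefl. Qed.

Lemma noncomm_sym u v : noncomm u v = noncomm v u.
Proof. by rewrite /noncomm adj_sym. Qed.

(* y k v is the signed length of the piece v in layer k; every piece rests on a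
   piece of the previous layer with which it does not commute, and a piece of
   length less than 1 has no piece above it with which it does not commute. *)
Record tetris y : Prop := Tetris {
  tet_le1 : forall k v, `|y k v| <= 1;
  tet_clique : forall k u v, y k u != 0 -> y k v != 0 -> noncomm u v -> u = v;
  tet_support : forall k v, y k.+1 v != 0 ->
    exists u, [/\ noncomm u v, y k u != 0 & u = v -> 0 < y k.+1 v * y k v];
  tet_full : forall j k u v, (j < k)%N -> y j u != 0 -> y k v != 0 ->
    noncomm u v -> `|y j u| = 1;
  tet_fin : exists K, forall k v, (K <= k)%N -> y k v = 0 }.

Definition sg b : R := if b then 1 else -1.

Definition discrete y := forall k v, [\/ y k v = 0, y k v = 1 | y k v = -1].

Lemma discrete_sg m k v b : discrete m -> m k v != 0 -> m k v != - sg b ->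
  m k v = sg b.
Proof.
move=> /(_ k v)[]->; rewrite ?eqxx //; case: b; rewrite /sg ?opprK ?eqxx //.
Qed.

(** A piece [v] dropped on the heap comes to rest in layer [k]: all pieces from there on commute
    with [v] and, if [k] is positive, the layer just below holds a piece that does not. *)
Definition is_height m v k :=
  (forall j u, (k <= j)%N -> noncomm u v -> m j u = 0) /\
  (forall j, k = j.+1 -> exists2 u, noncomm u v & m j u != 0).

Definition height m v : nat := xget 0%N (is_height m v).

Lemma is_height_uniq m v k k' : is_height m v k -> is_height m v k' -> k = k'.
Proof.
suff le k1 k2 : is_height m v k1 -> is_height m v k2 -> (k1 <= k2)%N.
  by move=> h h'; apply/eqP; rewrite eqn_leq !le.
move=> [_ h1] [h2 _]; rewrite leqNgt; apply/negP => lt.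
case: k1 h1 lt => // k1 /(_ _ erefl)[u uv /negP m0] lt; apply: m0.
by rewrite h2.
Qed.

Lemma heightP m v : (exists K, forall k u, (K <= k)%N -> m k u = 0) ->
  is_height m v (height m v).
Proof.
move=> [K mK]; rewrite /height; apply: (@xgetPex _ _ (is_height m v)).
have {mK} : forall k u, (K <= k)%N -> noncomm u v -> m k u = 0.
  by move=> k u le _; apply: mK.
elim: K => [|K IH] mK; first by exists 0%N; split=> // j u _; apply: mK.
have [[u uv mu]|no] := pselect (exists2 u, noncomm u v & m K u != 0).
  by exists K.+1; split=> [j w|j [<-]]; [apply: mK|exists u].
apply: IH => k u; rewrite leq_eqVlt => /predU1P[<- uv|]; last exact: mK.
by apply/eqP/negPn/negP => mu; apply: no; exists u.
Qed.

(** The layer in which the letter [(v, b)] acts: the one just below the height if it holds an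
    inverse piece, the height otherwise. At height 0 the truncated predecessor is layer 0, which
    does not contain [v], so nothing is subtracted. *)
Definition slot m v b : nat :=
  (height m v - (m (height m v).-1 v == - sg b))%N.

(** Adding [sg l.2] covers both cases: it fills an empty slot with a new piece and annihilates an
    inverse piece. *)
Definition step m (l : V * bool) : nat -> V -> R := fun k u =>
  m k u + (if (k == slot m l.1 l.2) && (u == l.1) then sg l.2 else 0).

(** Height and slot depend only on the pieces that do not commute with [v], so changes at letters
    adjacent to [v] leave them in place. *)
Lemma eq_slot m m' v b :
  (forall k u, noncomm u v -> m k u = m' k u) -> slot m v b = slot m' v b.
Proof.
move=> mm'; have hh : is_height m v = is_height m' v.
  apply/funext => k; apply/propext; rewrite /is_height; split=> -[clr sup].
    by split=> [j u kj uv|j /sup[u uv mu]]; [rewrite -mm' ?clr|exists u; rewrite -?mm'].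
  by split=> [j u kj uv|j /sup[u uv mu]]; [rewrite mm' ?clr|exists u; rewrite ?mm'].
by rewrite /slot /height hh mm' ?noncomm_refl.
Qed.

Lemma sg_neq0 b : sg b != 0.
Proof. by case: b; rewrite /sg ?oppr_eq0 oner_eq0. Qed.

Lemma sg_neqN b : sg b != - sg b.
Proof. by case: b; rewrite /sg ?opprK; apply/negP => /eqP; lra. Qed.

Lemma sgN b : sg (~~ b) = - sg b.
Proof. by case: b; rewrite /sg ?opprK. Qed.

Lemma sgM b : sg b * sg b = 1.
Proof. by case: b; rewrite /sg ?mulrNN mulr1. Qed.

(* Appending the letter l either cancels an inverse letter that is free on top
   of the heap (first case) or adds a new piece (second case). *)
Variant slot_spec m v b : nat -> Prop :=
| SlotCancel j : is_height m v j.+1 -> m j v = - sg b -> slot_spec m v b j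
| SlotNew k : is_height m v k -> (forall j, k = j.+1 -> m j v != - sg b) ->
    m k v = 0 -> slot_spec m v b k.

Lemma slotP m v b : (exists K, forall k u, (K <= k)%N -> m k u = 0) ->
  slot_spec m v b (slot m v b).
Proof.
move=> /heightP-/(_ v) hm; rewrite /slot; move: (height m v) hm => [|k] hm.
  have m0 : m 0%N v = 0 by apply: hm.1; rewrite ?noncomm_refl.
  rewrite m0 eq_sym oppr_eq0 (negbTE (sg_neq0 b)).
  by constructor 2.
have m0 : m k.+1 v = 0 by apply: hm.1; rewrite ?noncomm_refl.
rewrite /=; case: eqP => [mk|/eqP mk]; first by rewrite subn1; constructor 1.
by rewrite subn0; constructor 2 => // j [<-].
Qed.

Lemma discrete_norm m k v : discrete m -> m k v != 0 -> `|m k v| = 1.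
Proof. by move=> /(_ k v)[]->; rewrite ?eqxx // ?normrN normr1. Qed.

Lemma discrete_step m l : tetris m -> discrete m -> discrete (step m l).
Proof.
case: l => v b mT mD k u; rewrite /step /=.
case: (slotP v b (tet_fin mT)) => [j hj mj|j hj _ mj];
  case: eqP => [->|_] /=; rewrite ?addr0 //; case: eqP => [->|_] /=; rewrite ?addr0 //;
  rewrite mj ?addNr ?add0r; [by constructor 1|case: (b); by [constructor 2|constructor 3]].
Qed.

(** A cancelled piece carries nothing, since the pieces above it commute with [v]. A new piece rests
    on the piece that determines the height; if that is again [v], the signs agree, as otherwise it
    would have been cancelled. *)
Lemma tetris_step m l : tetris m -> discrete m -> tetris (step m l).
Proof.
move=> mT mD; have mD' := discrete_step l mT mD.
have full k v : step m l k v != 0 -> `|step m l k v| = 1 by exact: discrete_norm.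
case: l mD' full => v b mD' full.
suff [clique supp fin] :
  [/\ forall k u w, step m (v, b) k u != 0 -> step m (v, b) k w != 0 ->
         noncomm u w -> u = w,
      forall k w, step m (v, b) k.+1 w != 0 ->
         exists u, [/\ noncomm u w, step m (v, b) k u != 0 &
                       u = w -> 0 < step m (v, b) k.+1 w * step m (v, b) k w] &
      exists K, forall k w, (K <= k)%N -> step m (v, b) k w = 0].
  by split=> // [k u|j k u w _ /full //]; case: (mD' k u) => ->;
    rewrite ?normrN ?normr1 ?normr0 ?ler01.
clear mD' full.
rewrite /step /=; case: (slotP v b (tet_fin mT)) => [s hs ms|s hs ms ms0].
  have sub k u : m k u + (if (k == s) && (u == v) then sg b else 0) != 0 ->
      m k u != 0 /\ m k u + (if (k == s) && (u == v) then sg b else 0) = m k u.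
    by case: ifP => [/andP[/eqP-> /eqP->]|_]; rewrite ?ms ?addNr ?eqxx ?addr0.
  split.
  - by move=> k u w /sub[mu _] /sub[mw _]; apply: tet_clique mw.
  - move=> k w /sub[mw ->]; have [u [uw mu pos]] := tet_support mT mw.
    suff ks : ((k == s) && (u == v)) = false.
      exists u; split=> //; rewrite ?ks ?addr0 //.
      by move=> E; rewrite -E ks addr0 E; apply: pos.
    apply/negP => /andP[/eqP E1 /eqP E2]; subst k u.
    by move/negP: mw; apply; rewrite hs.1 // noncomm_sym.
  - have [K mK] := tet_fin mT; exists K => k w Kk.
    rewrite mK //; case: ifP; rewrite ?addr0 // => /andP[/eqP E _].
    move: ms; rewrite mK -?E // => /eqP; rewrite eq_sym oppr_eq0.
    by rewrite (negbTE (sg_neq0 b)).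
have old k u : m k u != 0 ->
    m k u + (if (k == s) && (u == v) then sg b else 0) = m k u.
  by case: ifP => [/andP[/eqP-> /eqP->]|_]; rewrite ?ms0 ?eqxx ?addr0.
have new k u : m k u + (if (k == s) && (u == v) then sg b else 0) != 0 ->
    m k u != 0 \/ k = s /\ u = v.
  by case: ifP => [/andP[/eqP-> /eqP->]|_]; [right|rewrite addr0; left].
have clr k u : (s <= k)%N -> m k u != 0 -> ~~ noncomm u v.
  by move=> sk mu; apply/negP => uv; move: mu; rewrite hs.1 ?eqxx.
split.
- move=> k u w /new[mu|[E1 E2]] /new[mw|[E3 E4]]; subst => //.
  + exact: tet_clique mw.
  + by rewrite (negbTE (clr _ _ _ mu)).
  + by rewrite noncomm_sym (negbTE (clr _ _ _ mw)).
- move=> k w /new[mw|[E1 E2]].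
    have [u [uw mu pos]] := tet_support mT mw.
    exists u; split=> //; first by rewrite old.
    by move=> E; rewrite !old // -?E //; subst; apply: pos.
  rewrite E1 E2 ms0 !eqxx add0r /=; have [u uv mu] := hs.2 k (esym E1).
  exists u; split=> //; first by rewrite old.
  move=> E; move: mu; rewrite E -E1 ltn_eqF //= addr0 => mu.
  rewrite (discrete_sg mD mu (ms _ (esym E1))).
  by rewrite sgM ltr01.
- have [K mK] := tet_fin mT; exists (maxn K s.+1) => k w.
  by rewrite geq_max => /andP[Kk sk]; rewrite mK // gtn_eqF // addr0.
Qed.

Lemma step_comm m u v b c : adj u v ->
  step (step m (u, b)) (v, c) = step (step m (v, c)) (u, b).
Proof.
move=> uv; apply/funext => k; apply/funext => w; rewrite /step /= -!addrA.
rewrite (@eq_slot (step m (u, b)) m v c) => [|j x xv]; last first.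
  rewrite /step /=; case: (x =P u) => [E|_]; last by rewrite andbF addr0.
  by move: xv; rewrite E /noncomm uv.
rewrite (@eq_slot (step m (v, c)) m u b) => [|j x xv]; last first.
  rewrite /step /=; case: (x =P v) => [E|_]; last by rewrite andbF addr0.
  by move: xv; rewrite E /noncomm adj_sym uv.
by congr (_ + _); rewrite addrC.
Qed.

(** After an addition the new piece lies on top, ready to be cancelled. After a cancellation in
    layer [s], what supported the removed piece shows that the height is now [s], and the sign
    condition in [tet_support] excludes a second cancellation one layer below. *)
Lemma slot_stepN m v b : tetris m -> discrete m ->
  slot (step m (v, b)) v (~~ b) = slot m v b.
Proof.
move=> mT mD; have yT := tetris_step (v, b) mT mD.
have Ey k u : step m (v, b) k u = m k u +
  (if (k == slot m v b) && (u == v) then sg b else 0) by [].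
case: (slotP v b (tet_fin mT)) Ey => [s hs ms|s hs ms ms0] Ey.
  have hy : is_height (step m (v, b)) v s.
    split=> [k u|k sk].
      rewrite Ey leq_eqVlt eq_sym => /predU1P[->|lt] uv.
        rewrite eqxx /=; case: eqP => [->|/eqP uv']; first by rewrite ms addNr.
        rewrite addr0; apply/eqP/negPn/negP => mu; move/negP: uv'; apply.
        by apply/eqP/(tet_clique mT mu) => //; rewrite ms oppr_eq0 sg_neq0.
      by rewrite gtn_eqF // addr0 hs.1.
    have mv : m k.+1 v != 0 by rewrite -sk ms oppr_eq0 sg_neq0.
    have [u [uv mu _]] := tet_support mT mv.
    by exists u; rewrite // Ey sk ltn_eqF // addr0.
  case: (slotP v (~~ b) (tet_fin yT)) => [j hj|j hj _ _]; last exact: is_height_uniq hy.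
  have E := is_height_uniq hj hy; rewrite Ey -E ltn_eqF // addr0 sgN opprK => mj.
  have mv : m j.+1 v != 0 by rewrite E ms oppr_eq0 sg_neq0.
  have [u [uv mu]] := tet_support mT mv.
  have mv' : m j v != 0 by rewrite mj sg_neq0.
  have uv' := tet_clique mT mu mv' uv.
  by move=> /(_ uv'); rewrite E ms mj mulNr sgM oppr_gt0 ltr10.
have hy : is_height (step m (v, b)) v s.+1.
  split=> [k u sk uv|k [<-]]; first by rewrite Ey gtn_eqF // addr0 hs.1 // ltnW.
  by exists v; rewrite ?noncomm_refl // Ey !eqxx ms0 add0r sg_neq0.
case: (slotP v (~~ b) (tet_fin yT)) => [j hj _|j hj].
  by have [] := is_height_uniq hj hy.
rewrite (is_height_uniq hj hy) => /(_ s erefl); rewrite Ey !eqxx ms0 sgN opprK.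
by rewrite add0r eqxx.
Qed.

Lemma stepK m v b : tetris m -> discrete m -> step (step m (v, b)) (v, ~~ b) = m.
Proof.
move=> mT mD; apply/funext => k; apply/funext => u.
rewrite {1}/step /= slot_stepN // /step /= -addrA; case: ifP => _.
  by rewrite sgN subrr addr0.
by rewrite !addr0.
Qed.

Definition walk m (s : seq (V * bool)) := foldl step m s.

Lemma walk_tetris m (s : seq (V * bool)) :
  tetris m -> discrete m -> tetris (walk m s) /\ discrete (walk m s).
Proof.
elim: s m => //= l s IH m mT mD; apply: IH; [exact: tetris_step|exact: discrete_step].
Qed.

(** The right action of words on integral heaps descends to the group because the defining rules
    hold for heaps: cancellation is [stepK], commutation is [step_comm]. *)
Lemma walk_pres m (s s' : seq (V * bool)) : tetris m -> discrete m ->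
  pres_eq (@raag_relation V) s s' -> walk m s = walk m s'.
Proof.
move=> mT mD E; elim: E m mT mD => {s s'}.
- by [].
- by move=> s s' _ IH m mT mD; rewrite IH.
- by move=> s s' s'' _ IH1 _ IH2 m mT mD; rewrite IH1 ?IH2.
- move=> s1 s1' s2 s2' _ IH1 _ IH2 m mT mD; rewrite /walk !foldl_cat -!/(walk _ _).
  by have [? ?] := walk_tetris s1 mT mD; rewrite IH2 // IH1.
- by move=> v b m mT mD; apply: stepK.
- by move=> s s' [u v uv] m mT mD; apply: step_comm.
Qed.

Definition empty_tetris : nat -> V -> R := fun _ _ => 0.

Lemma empty_tetrisP : tetris empty_tetris.
Proof.
split; rewrite /empty_tetris; do ?by move=> *; rewrite ?normr0 ?ler01.
- by move=> k u v; rewrite eqxx.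
- by move=> k v; rewrite eqxx.
- by move=> j k u v _; rewrite eqxx.
- by exists 0%N.
Qed.

Lemma empty_discrete : discrete empty_tetris.
Proof. by move=> k v; constructor 1. Qed.

Definition tet (g : raag V) := walk empty_tetris (repr g).

Lemma tet_class (s : seq (V * bool)) :
  tet (pres_class (@raag_relation V) s) = walk empty_tetris s.
Proof.
apply: (walk_pres empty_tetrisP empty_discrete).
by apply/pres_class_eq; rewrite pres_class_repr.
Qed.

Lemma tetP g : tetris (tet g).
Proof. by have [] := walk_tetris (repr g) empty_tetrisP empty_discrete. Qed.

Lemma tet_discrete g : discrete (tet g).
Proof. by have [] := walk_tetris (repr g) empty_tetrisP empty_discrete. Qed.

End Tetris.

(** * Integral heaps and elements of a right-angled Artin group *)

Section RaagWords.
Variable V : sgraph.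
Implicit Types (u v : V) (b : bool).

Notation relation := (@raag_relation V).

Lemma class_cat s t : pres_class relation (s ++ t) =
  (pres_class relation s * pres_class relation t)%g.
Proof. by rewrite [RHS]pres_mulE. Qed.

Definition letter (l : V * bool) : raag V :=
  if l.2 then raag_gen l.1 else (raag_gen l.1)^-1%g.

Lemma letterE l : letter l = pres_class relation [:: l].
Proof.
case: l => v [] //=; rewrite /letter /=; apply: mulg1_eq.
by rewrite -class_cat; apply/pres_class_eq/(pres_cancel _ v true).
Qed.

Lemma class_rcons s l : pres_class relation (rcons s l) =
  (pres_class relation s * letter l)%g.
Proof. by rewrite -cats1 class_cat letterE. Qed.

Lemma class_reprK (g : raag V) : pres_class relation (repr g) = g.
Proof. exact: pres_class_repr. Qed.

Lemma gen_commute u v : adj u v -> commute (raag_gen u) (raag_gen v).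
Proof.
move=> uv; rewrite /commute /raag_gen /pres_gen -!class_cat.
by apply/pres_class_eq/pres_relator; constructor.
Qed.

Lemma letter_commute u v b c : adj u v -> commute (letter (u, b)) (letter (v, c)).
Proof.
move=> /gen_commute uv; rewrite /letter /=.
have uv' : commute (raag_gen u) (if c then raag_gen v else (raag_gen v)^-1)%g.
  by case: c => //; apply: commuteV.
by case: b => //; apply/commute_sym/commuteV/commute_sym.
Qed.

Lemma raag_ind (P : raag V -> Prop) : P 1%g ->
  (forall g l, P g -> P (g * letter l)%g) -> forall g, P g.
Proof.
move=> P1 PM g; rewrite -(class_reprK g).
elim/last_ind: (repr g) => [|s l IH]; first exact: P1.
by rewrite class_rcons; apply: PM.
Qed.

Lemma raag_morph_eq (G : groupType) (f h : {multiplicative raag V -> G}) :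
  (forall v, f (raag_gen v) = h (raag_gen v)) -> f =1 h.
Proof.
move=> fh; apply: raag_ind => [|g [v b] IH]; first by rewrite !morph1.
by rewrite !gmulfM IH /letter; case: b => /=; rewrite ?morphV fh.
Qed.

End RaagWords.

(** * Reconstruction of a group element from its heap *)

Section NormalForm.
Variables (R : realType) (V : sgraph).
Implicit Types (m : nat -> V -> R) (u v : V) (b : bool) (k : nat).

Local Notation tet := (@tet R V).
Local Notation sg := (@sg R).

Lemma tet1 : tet 1%g = @empty_tetris R V.
Proof. exact: (tet_class R [::]). Qed.

Lemma tetM g l : tet (g * letter l)%g = step (tet g) l.
Proof.
rewrite -{1}(class_reprK g) -class_rcons tet_class -cats1.
by rewrite /walk foldl_cat.
Qed.

Lemma tet_walk g s : tet (g * pres_class _ s)%g = walk (tet g) s.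
Proof.
by rewrite -{1}(class_reprK g) -class_cat tet_class /walk foldl_cat.
Qed.

Lemma top_piece m : tetris m -> discrete m -> m <> @empty_tetris R V ->
  exists L v b, [/\ m L v = sg b & forall k u, (L < k)%N -> m k u = 0].
Proof.
move=> mT mD m0; have [K mK] := tet_fin mT.
have [p0 mp0] : exists p : 'I_K * V, m p.1 p.2 != 0.
  apply: contra_notP m0 => no; apply/funext => k; apply/funext => u.
  apply/eqP/negPn/negP => mu; apply: no.
  have kK : (k < K)%N by rewrite ltnNge; apply: contra mu => /mK->.
  by exists (Ordinal kK, u).
case: (@arg_maxnP _ p0 (fun p : 'I_K * V => m p.1 p.2 != 0)
         (fun p => p.1 : nat) mp0) => -[L v] /= mLv max.
exists L, v; have [E|] := eqVneq (m L v) (- sg true).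
  exists false; split=> // k u Lk; apply/eqP/negPn/negP => mu.
  have kK : (k < K)%N by rewrite ltnNge; apply: contra mu => /mK->.
  by have := max (Ordinal kK, u) mu; rewrite leqNgt Lk.
move=> E; exists true; split; first exact: discrete_sg.
move=> k u Lk; apply/eqP/negPn/negP => mu.
have kK : (k < K)%N by rewrite ltnNge; apply: contra mu => /mK->.
by have := max (Ordinal kK, u) mu; rewrite leqNgt Lk.
Qed.

Lemma top_height m L v b : m L v = sg b ->
  (forall k u, (L < k)%N -> m k u = 0) -> is_height m v L.+1.
Proof.
move=> mL top; split=> [k u Lk _|k [<-]]; first exact: top.
by exists v; rewrite ?noncomm_refl // mL sg_neq0.
Qed.

(** Induction on the number of pieces: the inverse letter of a piece in the last layer removes this
    piece, and a preimage of the smaller heap is then multiplied by the letter. *)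
Lemma tet_surj m : tetris m -> discrete m -> exists g, tet g = m.
Proof.
move=> mT mD; have [K mK] := tet_fin mT.
move En : #|[pred p : 'I_K * V | m p.1 p.2 != 0]| => n.
elim: n => [|n IH] in m mT mD mK En *.
  exists 1%g; rewrite tet1; apply/funext => k; apply/funext => u.
  case: (ltnP k K) => [kK|/mK-> //]; apply/esym/eqP/negPn/negP => mu.
  by have /card0_eq/(_ (Ordinal kK, u)) := En; rewrite !inE mu.
have [E|/(top_piece mT mD)[L [v [b [mL top]]]]] := pselect (m = @empty_tetris R V).
  by exists 1%g; rewrite tet1.
have LK : (L < K)%N.
  by rewrite ltnNge; apply/negP => /(mK _ v)/eqP; rewrite mL (negbTE (sg_neq0 _ _)).
have hm := top_height mL top.
have sL : slot m v (~~ b) = L.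
  case: (slotP v (~~ b) (tet_fin mT)) => [j /is_height_uniq/(_ hm)[]//|k].
  move=> /is_height_uniq/(_ hm)-> /(_ L erefl).
  by rewrite mL sgN opprK eqxx.
have stepE k u : step m (v, ~~ b) k u = if (k == L) && (u == v) then 0 else m k u.
  rewrite /step /= sL; case: ifP => [/andP[/eqP-> /eqP->]|_]; last by rewrite addr0.
  by rewrite mL sgN subrr.
have [g gE] : exists g, tet g = step m (v, ~~ b).
  apply: IH; [exact: tetris_step|exact: discrete_step| |].
    by move=> k u kK; rewrite stepE mK ?if_same.
  move: En; rewrite (cardD1 (Ordinal LK, v)) inE /= mL sg_neq0 => -[<-].
  apply: eq_card => -[k u]; rewrite !inE /= stepE xpair_eqE -val_eqE /=.
  by case: ((_ == L) && _); rewrite ?eqxx.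
exists (g * letter (v, b))%g; rewrite tetM gE.
by rewrite -{2}(negbK b) stepK.
Qed.

(** Integral heaps only have the lengths 0, 1 and -1; at any other length the value 1 is a
    default. *)
Definition piece (x : R) v : raag V :=
  if x == 1 then raag_gen v else if x == -1 then (raag_gen v)^-1%g else 1%g.

Lemma piece_sg b v : piece (sg b) v = letter (v, b).
Proof.
rewrite /piece /letter /sg ; case: b; rewrite ?eqxx //=.
by case: eqP => // /eqP; rewrite eq_sym -addr_eq0 -[1 + 1]/2%:R pnatr_eq0.
Qed.

Lemma piece0 v : piece 0 v = 1%g.
Proof.
by rewrite /piece eq_sym oner_eq0 eq_sym oppr_eq0 oner_eq0.
Qed.

(** In a heap, distinct letters of one layer commute, so the order of [enum V] is immaterial. *)
Definition layer_prod m k : raag V := (\prod_(u <- enum V) piece (m k u) u)%g.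
Definition heap_prod K m : raag V := (\prod_(k <- iota 0 K) layer_prod m k)%g.

Lemma piece_commute m k u v b : discrete m -> (m k u != 0 -> adj u v) ->
  commute (piece (m k u) u) (letter (v, b)).
Proof.
move=> mD uv; have [->|mu] := eqVneq (m k u) 0.
  by rewrite piece0; apply/commute_sym/commute1.
have [c ->] : exists c, m k u = sg c.
  by case: (mD k u) mu => ->; rewrite ?eqxx // => _; [exists true|exists false].
by rewrite piece_sg; apply/letter_commute/uv.
Qed.

Lemma piece_step x v b : x = 0 \/ x = - sg b ->
  piece (x + sg b) v = (piece x v * letter (v, b))%g.
Proof.
case=> ->; first by rewrite add0r piece0 mul1g piece_sg.
rewrite addNr piece0 -sgN piece_sg /letter /=.
by case: b => /=; rewrite ?mulgV ?mulVg.
Qed.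

(** The pieces above the slot and the other pieces in its layer commute with [v], so the appended
    letter can be moved left until it meets the piece in the slot. *)
Lemma heap_prod_step K m v b : tetris m -> discrete m -> (slot m v b < K)%N ->
  heap_prod K (step m (v, b)) = (heap_prod K m * letter (v, b))%g.
Proof.
move=> mT mD sK.
have stepE k u : step m (v, b) k u =
  if (k == slot m v b) && (u == v) then m k u + sg b else m k u.
  by rewrite /step /=; case: ifP; rewrite ?addr0.
have [s_ok clr layer] : [/\ m (slot m v b) v = 0 \/ m (slot m v b) v = - sg b,
   forall k u, (slot m v b < k)%N -> m k u != 0 -> adj u v &
   forall u, u != v -> m (slot m v b) u != 0 -> adj u v].
  case: (slotP v b (tet_fin mT)) => [s hs ms|s hs _ ms]; split; try by [left|right].
  - by move=> k u sk; apply: contraR => uv; rewrite hs.1.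
  - move=> u uv mu; apply: contraR uv => uv.
    by apply/eqP/(tet_clique mT mu) => //; rewrite ms oppr_eq0 sg_neq0.
  - by move=> k u sk; apply: contraR => uv; rewrite hs.1 // ltnW.
  - by move=> u _; apply: contraR => uv; rewrite hs.1.
move: (slot m v b) sK stepE s_ok clr layer => s sK stepE s_ok clr layer.
have iotaE : iota 0 K = iota 0 s ++ s :: iota s.+1 (K - s.+1).
  by rewrite -[s :: _]/(iota s (K - s.+1).+1) -iotaD subnSK // subnKC // ltnW.
have layer_neq k : k != s -> layer_prod (step m (v, b)) k = layer_prod m k.
  by move=> /negbTE ks; apply: eq_bigr => u _; rewrite stepE ks.
have layer_eq : layer_prod (step m (v, b)) s = (layer_prod m s * letter (v, b))%g.
  rewrite /layer_prod; have := enum_uniq V; have : v \in enum V by rewrite mem_enum.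
  case/splitPr => r1 r2; rewrite cat_uniq /= => /and4P[_ nh nr2 _].
  move: nh; rewrite negb_or => /andP[nr1 _].
  rewrite !big_cat !big_cons /= stepE !eqxx /= piece_step // -!mulgA; congr (_ * _)%g.
    apply: eq_big_seq => u ur; rewrite stepE eqxx /=; case: eqP => // E.
    by move: nr1; rewrite -E ur.
  congr (_ * _)%g; rewrite [RHS](_ : _ =
    letter (v, b) * \prod_(u <- r2) piece (m s u) u)%g.
    congr (_ * _)%g; apply: eq_big_seq => u ur; rewrite stepE eqxx /=.
    by case: eqP => // E; move: nr2; rewrite -E ur.
  apply/commute_sym; rewrite big_seq; apply: commute_prod => u ur.
  apply/commute_sym/piece_commute => // mu; apply: layer => //.
  by apply: contraNneq nr2 => <-.
rewrite /heap_prod iotaE !big_cat !big_cons /= layer_eq -!mulgA.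
congr (_ * (_ * _))%g.
  apply: eq_big_seq => k; rewrite mem_iota add0n => /andP[_ ks].
  by rewrite layer_neq // ltn_eqF.
rewrite [RHS](_ : _ = letter (v, b) *
   \prod_(k <- iota s.+1 (K - s.+1)) layer_prod m k)%g.
  congr (_ * _)%g; apply: eq_big_seq => k; rewrite mem_iota => /andP[sk _].
  by rewrite layer_neq // gtn_eqF.
apply/commute_sym; rewrite big_seq; apply: commute_prod => k.
rewrite mem_iota => /andP[sk _]; apply: commute_prod => u _.
by apply/commute_sym/piece_commute => // mu; apply: clr mu.
Qed.

Lemma heap_prod_tet g : exists K0, forall K, (K0 <= K)%N -> heap_prod K (tet g) = g.
Proof.
elim/raag_ind: g => [|g [v b] [K0 IH]].
  exists 0%N => K _; rewrite tet1 /heap_prod big1 // => k _.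
  by rewrite /layer_prod big1 // => u _; apply: piece0.
exists (maxn K0 (slot (tet g) v b).+1) => K; rewrite geq_max => /andP[K0K sK].
by rewrite tetM heap_prod_step ?IH //; [exact: tetP|exact: tet_discrete].
Qed.

Lemma tet_inj : injective tet.
Proof.
move=> g h gh; have [[K Kg] [K' Kh]] := (heap_prod_tet g, heap_prod_tet h).
by rewrite -(Kg (maxn K K')) ?leq_maxl // gh Kh // leq_maxr.
Qed.

End NormalForm.

(** * Central elements *)

Section Center.
Variables (R : realType) (V : sgraph).
Implicit Types (m : nat -> V -> R) (u v : V) (b : bool) (k : nat).

Local Notation tet := (@tet R V).
Local Notation sg := (@sg R).
Local Notation empty := (@empty_tetris R V).

Lemma walk_rcons m s l : walk m (rcons s l) = step (walk m s) l.
Proof. by rewrite /walk foldl_rcons. Qed.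

Lemma nseqSr T n (x : T) : nseq n.+1 x = rcons (nseq n x) x.
Proof. by elim: n => //= n <-. Qed.

(** The condition on the layer below the height prevents the first letter from cancelling anything;
    each later one lands on its predecessor, so the letters pile up. *)
Lemma walk_column m v b h n : tetris m -> discrete m ->
  is_height m v h -> (forall j, h = j.+1 -> m j v = sg b) ->
  is_height (walk m (nseq n (v, b))) v (h + n)%N /\
  forall k u, walk m (nseq n (v, b)) k u =
    if (h <= k < h + n)%N && (u == v) then sg b else m k u.
Proof.
move=> mT mD hm top; elim: n => [|n [IH1 IH2]].
  by rewrite addn0; split=> // k u; rewrite ltnNge andbN.
have [yT yD] := walk_tetris (nseq n (v, b)) mT mD.
rewrite nseqSr walk_rcons; move: (walk _ _) yT yD IH1 IH2 => y yT yD hy yE.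
have sE : slot y v b = (h + n)%N.
  case: (slotP v b (tet_fin yT)) => [j hj yj|k /is_height_uniq/(_ hy) //].
  have := is_height_uniq hj hy; move: yj; rewrite yE eqxx andbT.
  case: n {yE} hy => [|n] hy yj; rewrite ?addn0 ?addnS.
    move: yj; rewrite addn0 ltnNge andbN => yj /esym/top; rewrite yj => /eqP.
    by rewrite eq_sym (negbTE (sg_neqN _ _)).
  move=> [E]; move: yj; rewrite E leq_addr addnS ltnSn => /eqP.
  by rewrite (negbTE (sg_neqN _ _)).
have stepE k u : step y (v, b) k u =
    if (h <= k < h + n.+1)%N && (u == v) then sg b else m k u.
  rewrite /step /= sE yE addnS ltnS [(k <= _)%N]leq_eqVlt.
  have [->|nk] := eqVneq k (h + n)%N; last by rewrite addr0.
  rewrite ltnn andbF leq_addr /=; case: eqP => [->|_]; last by rewrite addr0.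
  by rewrite hm.1 ?add0r ?leq_addr ?noncomm_refl.
split=> //; split=> [k u|k]; rewrite addnS.
  move=> lk uv; rewrite stepE addnS [(k < _)%N]ltnNge lk andbF.
  by apply: hm.1 => //; apply: leq_trans (leq_addr n h) (ltnW lk).
move=> [<-]; exists v; rewrite ?noncomm_refl //.
by rewrite stepE leq_addr addnS ltnSn eqxx sg_neq0.
Qed.

(* Each letter removes at most the topmost piece of a column. *)
Lemma walk_column_stable m v b n s : tetris m -> discrete m ->
  (forall k, (k < n + size s)%N -> m k v = sg b) ->
  forall k, (k < n)%N -> walk m s k v = sg b.
Proof.
elim: s m => [|l s IH] m mT mD mv /=; first by rewrite addn0 in mv.
apply: IH; [exact: tetris_step|exact: discrete_step|move=> k kn].
rewrite /step /=; have [vl|vl] := eqVneq v l.1; last first.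
  by rewrite andbF addr0 mv // (leq_trans kn) //= addnS.
suff lt : (k < slot m l.1 l.2)%N.
  by rewrite ltn_eqF // addr0 mv // (leq_trans kn) //= addnS.
apply: leq_trans kn _; rewrite -vl.
have high j : is_height m v j -> (n + size s < j)%N.
  move=> hj; rewrite ltnNge; apply/negP => jn; have := mv (n + size s)%N.
    rewrite /= addnS ltnSn => /(_ isT)/eqP; rewrite hj.1 ?noncomm_refl //.
  by rewrite eq_sym (negbTE (sg_neq0 _ _)).
by case: (slotP v l.2 (tet_fin mT)) => [j /high|j /high/ltnW].
Qed.

(** The exponent sum of [v] in [g], with values in the additive group of [R] to be comparable with
    signed lengths of pieces. *)
Definition exponent v (g : raag V) : R :=
  @pres_lift _ (@raag_relation V) (Algebra.to_multiplicative R)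
    (fun u => if u == v then 1 else 0) g.

Lemma exponent_relation v s t : @raag_relation V s t ->
  @word_eval _ (Algebra.to_multiplicative R) (fun u => if u == v then 1 else 0) s =
  @word_eval _ (Algebra.to_multiplicative R) (fun u => if u == v then 1 else 0) t.
Proof.
by case=> x y _; rewrite /word_eval !big_cons !big_nil !mulg1; apply: addrC.
Qed.

Lemma exponentM v g h : exponent v (g * h)%g = exponent v g + exponent v h.
Proof. exact: (pres_liftM (@exponent_relation v)). Qed.

Lemma exponent1 v : exponent v 1%g = 0.
Proof. by apply: (addrI (exponent v 1%g)); rewrite -exponentM mulg1 addr0. Qed.

Lemma exponentV v g : exponent v g^-1%g = - exponent v g.
Proof. by apply: (addrI (exponent v g)); rewrite -exponentM mulgV exponent1 subrr. Qed.

Lemma exponent_letter v u b : exponent v (letter (u, b)) = if u == v then sg b else 0.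
Proof.
have E : exponent v (raag_gen u) = if u == v then 1 else 0.
  exact: (pres_lift_gen (@exponent_relation v)).
rewrite /letter; case: b; rewrite /= ?exponentV E //.
by case: ifP; rewrite ?oppr0.
Qed.

Lemma exponent_derived v g : derived g -> exponent v g = 0.
Proof.
elim=> [x y||x y _ xE _ yE|x _ xE].
- by rewrite /commg /conjg !exponentM !exponentV; lra.
- exact: exponent1.
- by rewrite exponentM xE yE addr0.
- by rewrite exponentV xE oppr0.
Qed.

(** Whether a letter creates or cancels a piece, it adds its sign to the total signed length of its
    column. *)
Lemma exponent_tet v g : exists K0, forall K, (K0 <= K)%N ->
  \sum_(k < K) tet g k v = exponent v g.
Proof.
elim/raag_ind: g => [|g [u b] [K0 IH]].
  by exists 0%N => K _; rewrite tet1 exponent1 big1.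
exists (maxn K0 (slot (tet g) u b).+1) => K; rewrite geq_max => /andP[K0K sK].
rewrite tetM exponentM exponent_letter -(IH K) // /step big_split /=; congr (_ + _).
rewrite (bigD1 (Ordinal sK)) //= eqxx /= [v == u]eq_sym big1 ?addr0 // => k.
by rewrite -val_eqE /= => /negbTE->.
Qed.

(* If v is the letter of a top piece of a central element c, at level L, then
   c v^n = v^n c for all n.  For large n the first L + 1 layers of the left-hand
   side are those of c, while on the right-hand side the letters of c are too few
   to destroy the bottom of the column v^n.  So c contains L + 1 equal letters v
   and no other v, and its exponent sum in v is not zero. *)
Lemma central_derived (c : raag V) : (forall v, commute c (raag_gen v)) ->
  derived c -> c = 1%g.
Proof.
move=> cC dc; have [cE|c0] := pselect (tet c = empty).
  by apply: (@tet_inj R V); rewrite tet1.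
have [L [v [b [cL top]]]] := top_piece (tetP R c) (tet_discrete R c) c0.
(* Each letter of [repr c] destroys at most one piece of the column, so at least [L.+1] pieces
   remain at the bottom. *)
set n := (L.+1 + size (repr c))%N.
have [_ upE] := walk_column n (tetP R c) (tet_discrete R c) (top_height cL top)
  (fun j e => etrans (congr1 (fun j => tet c j v) (esym (succn_inj e))) cL).
have h0 : is_height empty v 0 by split.
have [_ downE] := walk_column (b := b) n (empty_tetrisP R V) (@empty_discrete R V) h0
  (fun j e => match notF (congr1 (leq 1) e) with end).
have x_commute : commute c (pres_class _ (nseq n (v, b))).
  elim: (n) => [|i IH]; first exact: commute1.
  rewrite nseqSr class_rcons; apply: commuteM => //; rewrite /letter.
  by case: (b) => //=; apply: commuteV.
have E : walk (tet c) (nseq n (v, b)) = walk (walk empty (nseq n (v, b))) (repr c).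
  rewrite -tet_walk x_commute -[X in (_ * X)%g]class_reprK.
  by rewrite -[pres_class _ (nseq _ _)]mul1g !tet_walk tet1.
have cE k : (k < L.+1)%N -> tet c k v = sg b.
  move=> kL; have -> : tet c k v = walk (walk empty (nseq n (v, b))) (repr c) k v.
    by rewrite -E upE leqNgt kL.
  have [yT yD] := walk_tetris (nseq n (v, b)) (empty_tetrisP R V) (@empty_discrete R V).
  by apply: walk_column_stable kL => // j jn; rewrite downE jn eqxx.
have [K0 KE] := exponent_tet v c.
have := KE (K0 + L.+1)%N (leq_addr _ _).
rewrite (exponent_derived v dc) -(big_mkord xpredT (fun k => tet c k v)).
rewrite (@big_cat_nat _ _ _ L.+1) //= ?leq_addl // [X in _ + X]big_nat [X in _ + X]big1.
  rewrite addr0 big_mkord (eq_bigr (fun=> sg b)) => [|k _]; last by rewrite cE.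
  rewrite sumr_const card_ord => /eqP.
  by rewrite mulrn_eq0 (negbTE (sg_neq0 _ _)).
by move=> k /andP[Lk _]; rewrite top.
Qed.

End Center.

(** * Heaps close to an integral heap *)

Section Stars.
Variables (R : realType) (V : sgraph).
Implicit Types (m y : nat -> V -> R) (u v : V) (b : bool) (k : nat) (t : V -> R).

Local Notation tet := (@tet R V).

Definition clique_supported t :=
  forall u v, t u != 0 -> t v != 0 -> noncomm u v -> u = v.

(** Coordinates around the integral heap [m]: for each [v], a power of [v] with exponent [t v] is
    appended. The sign of [t v] decides whether it extends the heap or shortens an inverse piece on
    top, hence the slot. *)
Definition kappa m t : nat -> V -> R := fun k v =>
  m k v + (if k == slot m v (0 <= t v) then t v else 0).

(** As [t v] is less than 1, a shortened negative piece does not vanish, so every piece of [m] keeps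
    its sign and its role as a support. Nothing rests on a piece that was changed, because it is at
    or above the last layer of its column and [t] is supported on a clique. *)
Lemma kappa_tetris m t : tetris m -> discrete m -> clique_supported t ->
  (forall v, 0 <= t v < 1) -> tetris (kappa m t).
Proof.
move=> mT mD tC t01; pose y := kappa m t; rewrite -/y.
have t_ge0 v : 0 <= t v by case/andP: (t01 v).
have t_lt1 v : t v < 1 by case/andP: (t01 v).
have yE k v : y k v = m k v + (if k == slot m v true then t v else 0).
  by rewrite /y /kappa t_ge0.
have y_old k v : m k v != 0 -> y k v != 0 /\ 0 < y k v * m k v.
  rewrite yE; have := t_ge0 v; have := t_lt1 v.
  case: (mD k v) => ->; rewrite ?eqxx // => lt1 ge0 _; case: ifP => _;
    by rewrite ?addr0; split; (try by apply: lt0r_neq0; lra);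
       (try by apply: ltr0_neq0; lra); lra.
have y_new k v : y k v != 0 -> m k v != 0 \/
    [/\ is_height m v k, t v != 0, k = slot m v true, m k v = 0 &
        forall j, k = j.+1 -> m j v != -1].
  have [mk|mk] := eqVneq (m k v) 0; last by left.
  rewrite yE mk add0r; case: (k =P _) => [ks|_]; last by rewrite eqxx.
  move=> tv; right; split=> //;
    case: (slotP v true (tet_fin mT)) ks => [j hj mj|j hj mj mj0] E.
  - by move/eqP: mk; rewrite E mj oppr_eq0 (negbTE (sg_neq0 _ _)).
  - by rewrite E.
  - by move/eqP: mk; rewrite E mj oppr_eq0 (negbTE (sg_neq0 _ _)).
  - by move=> i Ei; apply: mj; rewrite -E.
split.
- move=> k v; rewrite yE; have := t_ge0 v; have := t_lt1 v => lt1 ge0.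
  case: (k =P _) => [->|_]; last by rewrite addr0 (tet_le1 mT).
  have : m (slot m v true) v = 0 \/ m (slot m v true) v = -1.
    by case: (slotP v true (tet_fin mT)) => [j _ ->|j _ _ ->]; [right|left].
  by rewrite ler_norml; case=> ->; apply/andP; split; lra.
- move=> k u v /y_new[mu|[hu tu _ _ _]] /y_new[mv|[hv tv _ _ _]] uv.
  + exact: tet_clique mv uv.
  + by move: mu; rewrite hv.1 ?eqxx.
  + by move: mv; rewrite hu.1 ?eqxx // noncomm_sym.
  + exact: tC.
- move=> k v /y_new[mv|[hv tv ks mv0 mN]].
    have [u [uv mu pos]] := tet_support mT mv; exists u; split=> //.
      by case: (y_old _ _ mu).
    move=> E; have := pos E; rewrite E in mu.
    have [_ p1] := y_old _ _ mu; have [_ p2] := y_old _ _ mv.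
    move: (mD k.+1 v) (mD k v) mu mv p1 p2 => + + /negP mu /negP mv.
    by case=> E1; case=> E2; rewrite E1 E2 in mu mv *; rewrite ?eqxx in mu mv; 
      rewrite ?mulr1 ?mulrN1 ?mul1r; nra.
  have [u uv mu] := hv.2 k erefl; exists u; split=> //.
    by case: (y_old _ _ mu).
  move=> E; rewrite E in mu.
  have m1 : m k v = 1 by case: (mD k v) mu (mN k erefl) => ->; rewrite ?eqxx.
  have tpos : 0 < t v by rewrite lt_neqAle eq_sym tv t_ge0.
  rewrite !yE mv0 m1 -ks eqxx ltn_eqF // addr0 mulr1 add0r //.
- move=> j k u v jk yu yv uv.
  have [mu|mu] := eqVneq (y j u) (m j u).
    by rewrite mu discrete_norm // -mu.
  have [tu js] : t u != 0 /\ j = slot m u true.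
    move: mu; rewrite yE -subr_eq0 addrAC subrr add0r.
    by case: (j =P _) => // _; rewrite eqxx.
  have clr : m k v = 0.
    have : (height m u <= j.+1)%N 
      by rewrite js /slot; case: (_ == _); rewrite ?subn0 ?subn1 // leqSpred.
    move=> hj; apply: (heightP u (tet_fin mT)).1; last by rewrite noncomm_sym.
    exact: leq_trans hj jk.
  move: yv => /y_new[|[_ tv ks _ _]]; first by rewrite clr eqxx.
  have E := tC u v tu tv uv; subst u.
  by move: jk; rewrite js ks ltnn.
- have [K mK] := tet_fin mT; exists (maxn K (\max_v (slot m v true).+1)) => k v.
  rewrite geq_max => /andP[Kk sk]; rewrite yE mK // add0r gtn_eqF //.
  by apply: leq_trans sk; apply: (leq_bigmax v).
Qed.

(* Moving along a negative edge from m is moving along a positive edge from the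
   other end of this edge. *)
Lemma kappa_step m t v : tetris m -> discrete m -> clique_supported t ->
  -1 < t v < 0 ->
  kappa (step m (v, false)) (fun u => if u == v then t v + 1 else t u) = kappa m t.
Proof.
move=> mT mD tC /andP[tv1 tv0]; apply/funext => k; apply/funext => u.
have tv : t v != 0 by rewrite lt_eqF.
rewrite /kappa; have [->|uv] := eqVneq u v.
  have -> : (0 <= t v + 1) = true by apply/idP; lra.
  rewrite (slot_stepN v false mT mD) [0 <= t v]leNgt tv0 /= /step /= eqxx andbT -addrA.
  by case: (k == _); rewrite ?addr0 // /sg [-1 + _]addrC addrK.
rewrite /step /= (negbTE uv) andbF addr0; congr (_ + _).
have [->|tu] := eqVneq (t u) 0; first by rewrite !if_same.
rewrite (@eq_slot _ _ (step m (v, false)) m) // => j w wu.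
rewrite /step /=; case: (w =P v) => [E|_]; last by rewrite andbF addr0.
by move: uv; rewrite (tC v u) ?eqxx // -E.
Qed.

(** Iterates [kappa_step]. When [s] lists all negative coordinates, those that result are
    nonnegative and [kappa_tetris] applies. *)
Lemma kappa_walk m t s : tetris m -> discrete m -> clique_supported t -> uniq s ->
  (forall v, v \in s -> -1 < t v < 0) ->
  kappa (walk m [seq (v, false) | v <- s])
        (fun v => if v \in s then t v + 1 else t v) = kappa m t.
Proof.
elim: s m t => [|v s IH] m t mT mD tC //= /andP[vs us] ts.
have tv := ts v (mem_head _ _).
pose t' u := if u == v then t v + 1 else t u.
rewrite -(kappa_step mT mD tC tv) -/t' -(IH (step m (v, false)) t') //.
- congr kappa; apply/funext => u; rewrite inE /t'.
  have [->|uv] /= := eqVneq u v; last by [].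
  by rewrite (negbTE vs).
- exact: tetris_step.
- exact: discrete_step.
- have t'0 u : t' u != 0 -> t u != 0.
    by rewrite /t'; case: (u =P v) => // -> _; case/andP: tv => _ /lt_eqF->.
  by move=> u w /t'0 tu /t'0; apply: tC.
- move=> u us'; rewrite /t' ifN; first by apply: ts; rewrite inE us' orbT.
  by apply: contraNneq vs => <-.
Qed.

(** A piece in layer [K.+1] would need a support of length 1 in layer [K], where [m] vanishes and
    [y] is closer than 1 to [m]. *)
Lemma star_tail m y K : tetris y -> (forall k v, (K <= k)%N -> m k v = 0) ->
  (forall k v, (k <= K)%N -> `|y k v - m k v| < 1) ->
  forall k v, (K < k)%N -> y k v = 0.
Proof.
move=> yT mK near; elim=> // k IH v; rewrite ltnS leq_eqVlt => /predU1P[E|Kk];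
  apply/eqP/negPn/negP => yv; have [u [uv yu _]] := tet_support yT yv; last first.
  by move: yu; rewrite IH ?eqxx.
have := tet_full yT (ltnSn k) yu yv uv; have := near k u.
by rewrite E leqnn (mK k) ?E // subr0 => /(_ isT) lt1 eq1; rewrite eq1 ltxx in lt1.
Qed.

Lemma near_discrete_neq0 m y k v : discrete m -> `|y k v - m k v| < 1 ->
  m k v != 0 -> y k v != 0.
Proof.
move=> /(_ k v) mD lt1 m0; apply: contraTneq lt1 => ->.
by rewrite sub0r normrN -leNgt; case: mD m0 => ->; rewrite ?eqxx // ?normrN normr1.
Qed.

Lemma near_discrete_full m y k v : discrete m -> `|y k v - m k v| < 1 ->
  `|y k v| = 1 -> m k v = y k v.
Proof.
move=> /(_ k v) mD; rewrite ltr_norml => /andP[h1 h2].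
move=> /eqP; rewrite eqr_norml ler01 andbT => /orP[]/eqP E; case: mD => mE;
  rewrite mE E in h1 h2 *; by [|exfalso; lra].
Qed.

(** A piece in which [y] differs from [m] has length strictly between 0 and 1 in absolute value, so
    no noncommuting piece of [y] lies above it. Hence each column contains at most one such piece,
    their letters form a clique, and the sum [t v] has at most one nonzero term. *)
Lemma star m y K : tetris m -> discrete m -> tetris y ->
  (forall k v, (K <= k)%N -> m k v = 0) ->
  (forall k v, (k <= K)%N -> `|y k v - m k v| < 1) ->
  let t := fun v => \sum_(k < K.+1) (y k v - m k v) in
  [/\ y = kappa m t, clique_supported t & forall v, -1 < t v < 1].
Proof.
move=> mT mD yT mK near0 t.
have near k v : `|y k v - m k v| < 1.
  have [/near0 //|kK] := leqP k K.
  by rewrite (star_tail yT mK near0) // mK ?subr0 ?normr0 ?ltr01 // ltnW.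
have frac k v : y k v != m k v -> y k v != 0 /\ `|y k v| != 1.
  move=> ym; split; last first.
    by apply: contra ym => /eqP/(near_discrete_full mD (near k v))->.
  apply: contra ym => /eqP yv; rewrite yv eq_sym; apply: contraT.
  by move=> /(near_discrete_neq0 mD (near k v)); rewrite yv eqxx.
have frac_top j k u v : y j u != m j u -> y k v != 0 -> noncomm u v -> (k <= j)%N.
  move=> /frac[yu yu1] yv uv; rewrite leqNgt; apply: contra yu1 => jk.
  by rewrite (tet_full yT jk yu yv uv).
have one j k u v : y j u != m j u -> y k v != m k v -> noncomm u v -> j = k /\ u = v.
  move=> yu yv uv; have [yu0 _] := frac _ _ yu; have [yv0 _] := frac _ _ yv.
  have E : j = k.
    apply/eqP; rewrite eqn_leq (frac_top _ _ _ _ yu yv0 uv).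
    by rewrite (frac_top _ _ _ _ yv yu0) // noncomm_sym.
  by subst j; split=> //; apply: (tet_clique yT yu0 yv0).
have tE k v : y k v != m k v -> t v = y k v - m k v.
  move=> ym; have kK : (k < K.+1)%N.
    rewrite ltnNge; apply: contra ym => Kk.
    by rewrite (star_tail yT mK near0) // mK // ltnW.
  rewrite /t (bigD1 (Ordinal kK)) //= big1 ?addr0 // => i ik.
  apply/eqP; rewrite subr_eq0; apply: contraT => ym'.
  have [E _] := one _ _ _ _ ym' ym (noncomm_refl v).
  by move: ik; rewrite -val_eqE /= E eqxx.
have tP v : t v != 0 -> exists2 k, y k v != m k v & t v = y k v - m k v.
  move=> tv; have [[k ym]|no] := pselect (exists k, y k v != m k v).
    by exists k => //; apply: tE.
  move/eqP: tv; case; rewrite /t big1 // => k _; apply/eqP; rewrite subr_eq0.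
  by apply: contraT => ym; case: no; exists k.
split.
(* Where [m k v] is 0, the support of the piece in [y] shows that [k] is the height. Otherwise [k]
   is just below the height and the bound 1 on lengths forces the difference to shorten the piece of
   [m]. *)
- have slotE k v : y k v != m k v -> k = slot m v (0 <= t v).
    move=> ym; rewrite (tE _ _ ym); have [yv _] := frac _ _ ym.
    have clr j u : (k < j)%N -> noncomm u v -> m j u = 0.
      move=> kj uv; apply/eqP; apply: contraT => /(near_discrete_neq0 mD (near j u)) yu.
      by have := frac_top _ _ _ _ ym yu; rewrite noncomm_sym uv leqNgt kj => /(_ isT).
    have yn1 := tet_le1 yT k v; have yfull := (frac _ _ ym).2.
    have [mv|mv] := eqVneq (m k v) 0.
      have hm : is_height m v k.
        split=> [j u|j E].
          rewrite leq_eqVlt => /predU1P[<-|]; last exact: clr.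
          move=> uv; apply/eqP; apply: contraT => mu.
          have yu := near_discrete_neq0 mD (near k u) mu.
          by have E := tet_clique yT yu yv uv; subst u; rewrite mv eqxx in mu.
        rewrite E in yv; have [u [uv yu _]] := tet_support yT yv.
        exists u => //; have y1 := tet_full yT (ltnSn j) yu yv uv.
        by rewrite (near_discrete_full mD (near j u) y1).
      case: (slotP v (0 <= y k v - m k v) (tet_fin mT)) => [j hj mj|j hj _ _].
        have E := is_height_uniq hm hj; subst k.
        have [u [uv yu pos]] := tet_support yT yv.
        have y1 := tet_full yT (ltnSn j) yu yv uv.
        have mjv : m j v != 0 by rewrite mj oppr_eq0 sg_neq0.
        have yjv := near_discrete_neq0 mD (near j v) mjv.
        have uE := tet_clique yT yu yjv uv; subst u.
        have := pos erefl; rewrite -(near_discrete_full mD (near j v) y1) mj mv subr0.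
        rewrite /sg; case: (lerP 0 (y j.+1 v)) => sgn; rewrite ?opprK => pos';
        by exfalso; nra.
      exact: is_height_uniq hm hj.
    have hm : is_height m v k.+1.
      by split=> // j [<-]; exists v; rewrite ?noncomm_refl.
    case: (slotP v (0 <= y k v - m k v) (tet_fin mT)) => [j hj _|j hj].
      by have [] := is_height_uniq hm hj.
    rewrite -(is_height_uniq hm hj) => /(_ k erefl) /eqP; case.
    move: yn1; rewrite ler_norml => /andP[y1 y2].
    case: (mD k v) mv => mE; rewrite mE ?eqxx // => _.
      rewrite leNgt; have -> : y k v - 1 < 0; last by rewrite /sg opprK.
      by rewrite lt_neqAle subr_eq0 -{1}mE ym subr_le0.
    by have -> : 0 <= y k v - -1; rewrite /sg //; lra.
  apply/funext => k; apply/funext => v; rewrite /kappa.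
  have [E|ym] := eqVneq (y k v) (m k v); last first.
    by rewrite -(slotE _ _ ym) eqxx (tE _ _ ym) addrCA subrr addr0.
  case: (k =P _) => [ks|_]; last by rewrite addr0.
  have [->|tv] := eqVneq (t v) 0; first by rewrite addr0.
  have [j ym _] := tP v tv.
  by have jk := slotE _ _ ym; move: ym; rewrite jk -ks E eqxx.
- move=> u v /tP[j yu _] /tP[k yv _] uv.
  by have [] := one _ _ _ _ yu yv uv.
- move=> v; have [->|/tP[k _ ->]] := eqVneq (t v) 0; first by apply/andP; split; lra.
  by rewrite -ltr_norml.
Qed.

End Stars.

(** * Heaps as points of the universal cover *)

Local Open Scope classical_set_scope.
Local Open Scope ring_scope.

Section Salvetti.
Variables (R : realType) (V : sgraph).
Implicit Types (m y : nat -> V -> R) (u v : V) (k : nat) (t : V -> R).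

Local Notation tet := (@tet R V).

Definition torus_cell (b : {ffun V -> R}) :=
  [forall v, 0 <= b v < 1] &&
  [forall u, forall v, [&& b u != 0, b v != 0 & noncomm u v] ==> (u == v)].

(* The Salvetti complex is the set of the points of the torus (R/Z)^V supported
   on a clique; coordinates in R/Z are represented in [0, 1[. *)
Definition salvetti := {b : {ffun V -> R} | torus_cell b}.
HB.instance Definition _ := [isSub of salvetti for @sval _ (fun x => torus_cell x)].
HB.instance Definition _ := [Choice of salvetti by <:].

Implicit Type b : salvetti.

Lemma salvetti_clique b : clique_supported (val b).
Proof.
have /andP[_ /forallP b2] := valP b => u v bu bv uv.
have /forallP/(_ v) := b2 u.
by rewrite bu bv uv => /eqP.
Qed.

Lemma salvetti01 b v : 0 <= val b v < 1.
Proof. by have /andP[/forallP b1 _] := valP b; apply: b1. Qed.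

Lemma salvetti_ex t : clique_supported t -> (forall v, 0 <= t v < 1) ->
  exists b, forall v, val b v = t v.
Proof.
move=> tC t01; have bP : torus_cell [ffun v => t v].
  apply/andP; split; first by apply/forallP => v; rewrite ffunE.
  apply/forallP => u; apply/forallP => v; apply/implyP; rewrite !ffunE.
  by move=> /and3P[tu tv uv]; apply/eqP/tC.
by exists (exist (fun x => torus_cell x) _ bP) => v; rewrite ffunE.
Qed.

Lemma salvetti_eq b b' : (forall v, val b v = val b' v) -> b = b'.
Proof. by move=> bb'; apply/val_inj/ffunP. Qed.

Lemma integer_frac_inj (x x' a a' : R) : [\/ x = 0, x = 1 | x = -1] ->
  [\/ x' = 0, x' = 1 | x' = -1] -> 0 <= a < 1 -> 0 <= a' < 1 ->
  x + a = x' + a' -> x = x' /\ a = a'.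
Proof.
by move=> + + /andP[a0 a1] /andP[a'0 a'1]; case=> ->; case=> -> E; split; lra.
Qed.

Definition salvetti_cover := (raag V * salvetti)%type.

Definition heap (e : salvetti_cover) : nat -> V -> R := kappa (tet e.1) (val e.2).

Lemma heapE e k v :
  heap e k v = tet e.1 k v + (if k == slot (tet e.1) v true then val e.2 v else 0).
Proof. by rewrite /heap /kappa; have /andP[-> _] := salvetti01 e.2 v. Qed.

Lemma heap_tetris e : tetris (heap e).
Proof.
apply: kappa_tetris; [exact: tetP|exact: tet_discrete|exact: salvetti_clique|].
exact: salvetti01.
Qed.

(** Each coordinate is an integer plus a number in [0, 1[ in a unique way. The integers give [g] by
    [tet_inj], and the remainders in the slots give [b]. *)
Lemma heap_inj : injective heap.
Proof.
move=> [g b] [g' b'] E.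
have cond (c : bool) b0 v : 0 <= (if c then val b0 v else 0) < 1.
  by case: c; rewrite ?salvetti01 // lexx ltr01.
have both k v := integer_frac_inj (tet_discrete R g k v) (tet_discrete R g' k v)
  (cond _ b v) (cond _ b' v)
  (etrans (esym (heapE (g, b) k v))
     (etrans (congr1 (fun y => y k v) E) (heapE (g', b') k v))).
have gg' : g = g'.
  by apply: (@tet_inj R V); apply/funext => k; apply/funext => v; case: (both k v).
subst g'; congr pair; apply: salvetti_eq => v.
by have [_] := both (slot (tet g) v true) v; rewrite /= eqxx.
Qed.

(** By [kappa_walk], a negative coordinate [t v] amounts to the inverse letter of [v] followed by
    the coordinate [t v + 1]; injectivity of [heap] then identifies both components of [e]. *)
Lemma chart (e : salvetti_cover) g t : heap e = kappa (tet g) t -> clique_supported t ->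
  (forall v, -1 < t v < 1) ->
  e.1 = (g * pres_class _ [seq (v, false) | v <- enum V & t v < 0])%g /\
  forall v, val e.2 v = if t v < 0 then t v + 1 else t v.
Proof.
move=> eE tC t1; pose t' v := if t v < 0 then t v + 1 else t v.
have t'P v : (t' v != 0 -> t v != 0) /\ 0 <= t' v < 1.
  have /andP[h1 h2] := t1 v; rewrite /t'; case: ltP => h3; split=> //.
  - by move=> _; rewrite lt_eqF.
  - by apply/andP; split; lra.
  - by rewrite h3.
have [b bE] : exists b, forall v, val b v = t' v.
  apply: salvetti_ex => [u v|v]; last by case: (t'P v).
  by have [tu _] := t'P u; have [tv _] := t'P v => /tu ? /tv ?; apply: tC.
pose e' : salvetti_cover :=
  ((g * pres_class _ [seq (v, false) | v <- enum V & t v < 0])%g, b).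
suff -> : e = e' by [].
apply: heap_inj; rewrite eE /heap /= tet_walk.
rewrite -(kappa_walk (tetP R g) (tet_discrete R g) tC
  (filter_uniq (fun v => t v < 0) (enum_uniq V))) => [|v].
  congr kappa; apply/funext => v.
  by rewrite bE mem_filter mem_enum andbT.
by rewrite mem_filter => /andP[t0 _]; rewrite t0; case/andP: (t1 v) => ->.
Qed.

(** The normalisation in [chart] depends on [t] alone, so left multiplication moves the centre of
    the chart and keeps the coordinates. *)
Lemma heap_mulg x e g t : heap e = kappa (tet g) t -> clique_supported t ->
  (forall v, -1 < t v < 1) -> heap ((x * e.1)%g, e.2) = kappa (tet (x * g)%g) t.
Proof.
move=> eE tC t1; have [e1 e2] := chart eE tC t1.
rewrite /heap /= e1 mulgA tet_walk.
rewrite -(kappa_walk (tetP R (x * g)%g) (tet_discrete R _) tC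
  (filter_uniq (fun v => t v < 0) (enum_uniq V))) => [|v].
  congr kappa; apply/funext => v.
  by rewrite e2 mem_filter mem_enum andbT.
by rewrite mem_filter => /andP[t0 _]; rewrite t0; case/andP: (t1 v) => ->.
Qed.

Lemma heap_surj y : tetris y -> exists e, heap e = y.
Proof.
(* All lengths are rounded down to integers, so that the coordinates of [y] around [m] lie in [0,
   1[. *)
move=> yT; pose m k v : R := if y k v == 1 then 1 else if y k v < 0 then -1 else 0.
have [m_disc m_le m_neq0 m_full] :
    [/\ discrete m, forall k v, m k v <= y k v < m k v + 1,
    forall k v, m k v != 0 -> y k v != 0 /\ 0 < m k v * y k v &
    forall k v, `|y k v| = 1 -> m k v = y k v].
  have mP k v : [/\ [\/ m k v = 0, m k v = 1 | m k v = -1], m k v <= y k v < m k v + 1,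
    m k v != 0 -> y k v != 0 /\ 0 < m k v * y k v & `|y k v| = 1 -> m k v = y k v].
    have := tet_le1 yT k v; rewrite ler_norml => /andP[h1 h2].
    rewrite /m; case: (y k v =P 1) => [->|/eqP h3].
      split; rewrite ?mulr1 ?ltr01 ?oner_neq0 //; first by constructor 2.
      by apply/andP; split; lra.
    case: ltP => h4; split=> //.
    - by constructor 3.
    - by apply/andP; split; lra.
    - by split; [rewrite lt_eqF|lra].
    - by rewrite ltr0_norm // => h5; lra.
    - by constructor 1.
    - by apply/andP; split=> //; rewrite add0r lt_neqAle h3.
    - by rewrite eqxx.
    - by rewrite ger0_norm // => h5; rewrite h5 eqxx in h3.
  by split=> k v; case: (mP k v).
have mT : tetris m.
  have sub k v : m k v != 0 -> y k v != 0 by case/m_neq0.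
  split.
  - by move=> k v; case: (m_disc k v) => ->; rewrite ?normrN ?normr1 ?normr0 ?ler01.
  - by move=> k u v /sub yu /sub; apply: tet_clique.
  - move=> k v mv; have [yv pv] := m_neq0 _ _ mv.
    have [u [uv yu pos]] := tet_support yT yv.
    have yu1 := m_full _ _ (tet_full yT (ltnSn k) yu yv uv).
    exists u; split; rewrite ?yu1 // => E; subst u; have := pos erefl; rewrite yu1.
    by case: (m_disc k.+1 v) (m_disc k v) pv mv yu1 => -> [] ->; rewrite ?eqxx //;
      move=> ? ? <-; lra.
  - by move=> j k u v _ mu _ _; apply: discrete_norm.
  - have [K yK] := tet_fin yT; exists K => k v Kk.
    by apply/eqP; apply: contraT => /sub; rewrite yK ?eqxx.
have [g gE] := tet_surj mT m_disc; have [K mK] := tet_fin mT.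
have near k v : `|y k v - m k v| < 1.
  by have /andP[h1 h2] := m_le k v; rewrite ltr_norml; apply/andP; split; lra.
have [] := star mT m_disc yT mK (fun k v _ => near k v).
set t := (X in kappa _ X) => yE tC t1.
have t0 v : 0 <= t v.
  by apply: sumr_ge0 => k _; rewrite subr_ge0; case/andP: (m_le k v).
have [b bE] : exists b, forall v, val b v = t v.
  by apply: salvetti_ex => // v; rewrite t0; case/andP: (t1 v).
exists (g, b); rewrite /heap /= gE yE; congr kappa.
by apply/funext => v; rewrite bE.
Qed.

End Salvetti.

(** * The covering action *)

Lemma cvg_initial (S : choiceType) (T : topologicalType) (f : S -> T)
    (F : set_system S) (s : S) : Filter F ->
  f @ F --> f s -> F --> (s : initial_topology f).
Proof.
move=> FF fF A /= [_ [[B oB <-] Bs BA]].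
have /fF FB : nbhs (f s) B by rewrite nbhsE; exists B.
exact: (@filterS _ F FF _ _ BA FB).
Qed.

Lemma continuous_subr (R : realType) (X : topologicalType) (f : X -> R) (c : R) x :
  {for x, continuous f} -> {for x, continuous (fun z => f z - c)}.
Proof. by move=> fc; apply: cvgB; [exact: fc|exact: cvg_cst]. Qed.

Lemma nbhs_forall (X : topologicalType) (I : finType) (P : I -> X -> Prop) (x : X) :
  (forall i, nbhs x (P i)) -> nbhs x (fun z => forall i, P i z).
Proof. exact: filter_forall. Qed.

Lemma continuous_near_eq (R : realType) (X : topologicalType) (f h : X -> R) x :
  (\forall z \near x, f z = h z) -> {for x, continuous h} -> {for x, continuous f}.
Proof.
move=> fh hc; rewrite /prop_for /continuous_at (nbhs_singleton fh).
apply: cvg_trans hc; apply: near_eq_cvg; apply: filterS fh => z; exact: esym.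
Qed.

Lemma near_norm_lt (R : realType) (X : topologicalType) (f : X -> R) (c : R) x :
  {for x, continuous f} -> `|f x| < c -> \forall z \near x, `|f z| < c.
Proof. by move=> fc; apply: cvgr_norm_lt; exact: fc. Qed.

Lemma continuous_sum (R : realType) (X : topologicalType) (I : Type) (s : seq I)
    (F : I -> X -> R) x : (forall i, {for x, continuous (F i)}) ->
  {for x, continuous (fun z => \sum_(i <- s) F i z)}.
Proof.
move=> Fc; elim: s => [|i s IH].
  rewrite [X in {for _, continuous X}](_ : _ = fun=> 0); first exact: cvg_cst.
  by apply/funext => z; rewrite big_nil.
rewrite [X in {for _, continuous X}](_ : _ = fun z => F i z + \sum_(j <- s) F j z).
  by apply: cvgD; [exact: Fc|exact: IH].
by apply/funext => z; rewrite big_cons.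
Qed.

Section Cover.
Variables (R : realType) (V : sgraph).
Implicit Types (u v : V) (k : nat) (t : V -> R).

Local Notation tet := (@tet R V).
Local Notation cover := (salvetti_cover R V).
Local Notation salvetti := (salvetti R V).

Definition cover_coord (p : nat * V) : cover -> R := fun e => heap e p.1 p.2.

(** The topology is that of pointwise convergence of heaps; nearby points may have different first
    components. *)
Definition cover_space : Type := cover.
HB.instance Definition _ := Topological.copy cover_space
  (sup_topology (fun p => Topological.class (initial_topology (cover_coord p)))).

Lemma heap_continuous k v : continuous (fun e : cover_space => heap e k v).
Proof.
move=> e; have /cvg_sup/(_ (k, v)) : nbhs e --> e by apply: cvg_id.
move=> id_cvg; apply: cvg_trans (@initial_continuous _ _ (cover_coord (k, v)) e).
exact: (cvg_app (cover_coord (k, v)) id_cvg).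
Qed.

Lemma cover_cvg (X : topologicalType) (h : X -> cover_space) x :
  (forall k v, {for x, continuous (fun z => heap (h z) k v)}) ->
  {for x, continuous h}.
Proof.
move=> hc; apply/cvg_sup => -[k v]; apply: cvg_initial; exact: hc.
Qed.

Definition chart_at (g : raag V) t (e : cover) :=
  [/\ heap e = kappa (tet g) t, clique_supported t & forall v, -1 < t v < 1].

(** The hypotheses of [star] concern only the layers up to [K], that is, finitely many coordinates,
    so they hold on a neighbourhood of [(g, b)]. *)
Lemma local_chart (g : raag V) (b : salvetti) :
  exists t : cover -> V -> R, [/\ forall v, continuous (fun e : cover_space => t e v),
    t (g, b) = val b :> (V -> R) &
    \forall e \near ((g, b) : cover_space), chart_at g (t e) e].
Proof.
have [K mK] := tet_fin (tetP R g).
exists (fun e v => \sum_(k < K.+1) (heap e k v - tet g k v)); split.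
- move=> v e; apply: continuous_sum => k; apply: continuous_subr.
  exact: heap_continuous.
- apply/funext => v; under eq_bigr do rewrite heapE addrC addKr /=.
  (* A new piece may lie in layer [K], just above all layers of [tet g]; therefore [K.+1] layers are
     summed. *)
  have sK : (slot (tet g) v true < K.+1)%N.
    rewrite ltnNge; apply/negP => Ks.
    case: (slotP v true (tet_fin (tetP R g))) Ks => [j hj mj|j hj _ _] Ks.
      by move/eqP: mj; rewrite mK ?(ltnW Ks) // eq_sym oppr_eq0 (negbTE (sg_neq0 _ _)).
    case: j hj Ks => // j hj; rewrite ltnS => Ks.
    by have [u _] := hj.2 j erefl; rewrite mK ?eqxx.
  rewrite (bigD1 (Ordinal sK)) //= eqxx big1 ?addr0 // => i.
  by rewrite -val_eqE /= => /negbTE->.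
have near_e : \forall e \near ((g, b) : cover_space), forall i : 'I_K.+1, forall v,
    `|heap e i v - tet g i v| < 1.
  apply: (@nbhs_forall cover_space _ (fun (i : 'I_K.+1) e =>
    forall v, `|heap e i v - tet g i v| < 1)) => i.
  apply: (@nbhs_forall cover_space _ (fun v e =>
    `|heap e i v - tet g i v| < 1)) => v.
  have c : {for (g, b) : cover_space,
      continuous (fun e : cover_space => heap e i v - tet g i v)}.
    by apply: continuous_subr; apply: heap_continuous.
  have lt1 : `|heap (g, b) i v - tet g i v| < 1.
    rewrite heapE addrC addKr /=; case: ifP; rewrite ?normr0 ?ltr01 // => _.
    by have /andP[b0 b1] := salvetti01 b v; rewrite ger0_norm.
  exact: near_norm_lt c lt1.
apply: filterS near_e => e near_e; rewrite /chart_at.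
apply: (star (K := K)) => //; [exact: tetP|exact: tet_discrete|exact: heap_tetris|].
by move=> k v kK; apply: (near_e (Ordinal (kK : (k < K.+1)%N))).
Qed.

Lemma kappa_continuous (X : topologicalType) (t : X -> V -> R) m k v x :
  {for x, continuous (fun z => t z v)} ->
  {for x, continuous (fun z => kappa m (t z) k v)}.
Proof.
(* The slot jumps when [t z v] changes sign, so [t z v] is split into its positive and negative
   parts, each of which has a fixed slot. *)
move=> tc; have E : (fun z => kappa m (t z) k v) = (fun z => m k v +
   ((k == slot m v true)%:R * Num.max (t z v) 0 +
    (k == slot m v false)%:R * Num.min (t z v) 0)).
  apply/funext => z; rewrite /kappa; congr (_ + _).
  by case: lerP => _; rewrite !(mulr0, addr0, add0r); case: (k == _); rewrite ?mul1r ?mul0r.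
rewrite E; apply: cvgD; first exact: cvg_cst.
apply: cvgD; apply: cvgM; try exact: cvg_cst.
- by apply: (@continuous_max R X (fun z => t z v) (fun=> 0)) => //; apply: cvg_cst.
- by apply: (@continuous_min R X (fun z => t z v) (fun=> 0)) => //; apply: cvg_cst.
Qed.

Definition translate (x : raag V) (e : cover) : cover := ((x * e.1)%g, e.2).

Lemma translate_continuous x : continuous (translate x : cover_space -> cover_space).
Proof.
case=> g b; apply: cover_cvg => k v.
have [t [tc _ near_t]] := local_chart g b.
have E : \forall e \near ((g, b) : cover_space),
    heap (translate x e) k v = kappa (tet (x * g)%g) (t e) k v.
  by apply: filterS near_t => e [eE tC t1]; rewrite /translate (heap_mulg _ eE).
apply: continuous_near_eq E _; apply: kappa_continuous; exact: tc.
Qed.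

(** On a neighbourhood where the coordinates stay within 1/2 of those of the centre, two points over
    the same point of S have coordinates that differ by integers smaller than 1 in absolute value,
    hence equal coordinates; [chart] then gives equal group elements. *)
Lemma translate_covering (e : cover_space) : exists U : set cover_space,
  [/\ open U, U e & forall x, U `&` translate x @` U !=set0 -> x = 1%g].
Proof.
case: e => g b; have [t [tc _ near_t]] := local_chart g b.
have near_d : \forall e \near ((g, b) : cover_space), forall v,
    `|t e v - t (g, b) v| < 1 / 2.
  apply: (@nbhs_forall cover_space _ (fun v e =>
    `|t e v - t (g, b) v| < 1 / 2)) => v.
  have c : {for (g, b) : cover_space,
      continuous (fun e : cover_space => t e v - t (g, b) v)}.
    by apply: continuous_subr; apply: tc.
  have lt1 : `|t (g, b) v - t (g, b) v| < 1 / 2 by rewrite subrr normr0; lra.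
  exact: near_norm_lt c lt1.
have := @filterI _ (nbhs ((g, b) : cover_space)) (nbhs_filter _) _ _ near_t near_d.
rewrite nbhsE => -[U [oU Ub] sU]; exists U; split=> // x [e [/sU Ue [e' /sU Ue' E]]].
subst e.
have {Ue}[[eE tC t1] d] := Ue; have {Ue'}[[eE' tC' t1'] d'] := Ue'.
have [E1 E2] := chart eE tC t1; have [E1' E2'] := chart eE' tC' t1'.
have tt : t (translate x e') = t e'.
  apply/funext => v; have := esym (E2 v); rewrite {1}/translate E2' /=.
  have /andP[a1 a2] := t1 v; have /andP[a1' a2'] := t1' v.
  have := d v; have := d' v; rewrite !ltr_norml => /andP[c1 c2] /andP[c3 c4].
  by case: ltP => h; case: ltP => h'; lra.
move: E1; rewrite tt /= -E1' => /eqP; rewrite -{2}[e'.1]mul1g => /eqP.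
exact: mulIg.
Qed.

End Cover.

(** * Contractibility *)

Section Contraction.
Variables (R : realType) (V : sgraph).
Implicit Types (u v : V) (k : nat) (y : nat -> V -> R) (s : R).

Local Notation salvetti := (salvetti R V).
Local Notation cover_space := (cover_space R V).

(** The bound on lengths in layer [k] at time [s]: it is 1 until 1/(k+2), decreases linearly, and is
    0 from 1/(k+1) on. *)
Definition theta k s : R :=
  Num.max 0 (Num.min 1 (k.+2%:R - k.+1%:R * k.+2%:R * s)).

Lemma theta0 k : theta k 0 = 1.
Proof.
rewrite /theta mulr0 subr0 min_l ?max_r ?ler01 //.
by rewrite ler1n.
Qed.

Lemma theta1 k : theta k 1 = 0.
Proof.
rewrite /theta mulr1 max_l //; rewrite ge_min; apply/orP; right.
rewrite -natrM subr_le0 ler_nat leq_pmull //.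
Qed.

Lemma theta_ge0 k s : 0 <= theta k s.
Proof. by rewrite le_max lexx. Qed.

Lemma theta_le1 k s : theta k s <= 1.
Proof. by rewrite ge_max ler01 ge_min lexx. Qed.

(* A layer starts to be erased only when all the layers above it are gone. *)
Lemma theta_full j k s : (j < k)%N -> theta k s != 0 -> theta j s = 1.
Proof.
move=> jk; rewrite /theta => th.
have {th} pos : 0 < k.+2%:R - k.+1%:R * k.+2%:R * s :> R.
  rewrite ltNge; apply: contra th => neg; rewrite max_l // ge_min.
  by rewrite neg orbT.
have k1 : 0 < k.+1%:R :> R by rewrite ltr0n.
have k2 : 0 < k.+2%:R :> R by rewrite ltr0n.
have s1 : k.+1%:R * s < 1.
  have : 0 < k.+2%:R * (1 - k.+1%:R * s) by lra.
  by rewrite pmulr_rgt0 // subr_gt0.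
have jk' : (j.+2%:R : R) <= k.+1%:R by rewrite ler_nat ltnS.
have j2 : (j.+2%:R : R) = j.+1%:R + 1 by rewrite -[in LHS]natr1.
have j1 : 0 < j.+1%:R :> R by rewrite ltr0n.
have js : j.+2%:R * s <= 1.
  have [s0|s0] := lerP 0 s; first by apply: le_trans (ltW s1); apply: ler_wpM2r.
  by apply: le_trans ler01; rewrite pmulr_rle0 ?ltr0n // ltW.
have goal : 1 <= j.+2%:R - j.+1%:R * j.+2%:R * s.
  have : j.+1%:R * (j.+2%:R * s) <= j.+1%:R * 1 by rewrite ler_pM2l.
  by rewrite mulrA mulr1 j2; lra.
by rewrite min_l // max_r ?ler01.
Qed.

Lemma theta_continuous k : continuous (theta k).
Proof.
have -> : theta k = (fun=> 0) \max ((fun=> 1) \min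
    (fun s => k.+2%:R - k.+1%:R * k.+2%:R * s)) by [].
move=> s; apply: continuous_max; first exact: cvg_cst.
apply: continuous_min; first exact: cvg_cst.
apply: cvgB; first exact: cvg_cst.
by apply: cvgM; [exact: cvg_cst|exact: cvg_id].
Qed.

Definition cut s y : nat -> V -> R := fun k v =>
  Num.max (- theta k s) (Num.min (theta k s) (y k v)).

Lemma cut_sub s y k v : cut s y k v != 0 ->
  [/\ theta k s != 0, y k v != 0 & 0 < cut s y k v * y k v].
Proof.
rewrite /cut; have th := theta_ge0 k s; move: (theta k s) th => x x0.
have [->|xn0] := eqVneq x 0.
  by rewrite oppr0; case: (lerP 0 (y k v)) => h; rewrite ?maxxx ?eqxx // max_l ?eqxx // ltW.
have {x0 xn0} x0 : 0 < x by rewrite lt_neqAle eq_sym xn0.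
have [->|yn0] := eqVneq (y k v) 0.
  by rewrite min_r ?ltW // max_r ?eqxx // oppr_le0 ltW.
move=> _; split; rewrite ?(gt_eqF x0) //.
have [y0|y0] := ltP 0 (y k v).
  have : 0 < Num.min x (y k v) by rewrite lt_min x0.
  move: (Num.min _ _) => z z0; rewrite max_r; last by lra.
  by rewrite mulr_gt0.
have {}y0 : y k v < 0 by rewrite lt_neqAle yn0.
rewrite min_r; last by lra.
have : Num.max (- x) (y k v) < 0 by rewrite gt_max oppr_lt0 x0.
by move: (Num.max _ _) => z z0; nra.
Qed.

Lemma cut_id s y k v : `|y k v| <= 1 -> theta k s = 1 -> cut s y k v = y k v.
Proof.
by rewrite /cut ler_norml => /andP[y1 y2] ->; rewrite min_r // max_r.
Qed.

(** Truncation keeps the signs of the remaining pieces and, by [theta_full], all layers below a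
    remaining piece are intact. *)
Lemma cut_tetris s y : tetris y -> tetris (cut s y).
Proof.
move=> yT; split.
- move=> k v; rewrite /cut ler_norml; have := theta_ge0 k s; have := theta_le1 k s.
  move=> h1 h2; rewrite le_max lerN2 h1 /= ge_max ge_min h1 /= andbT.
  by apply: le_trans ler01; rewrite oppr_le0.
- by move=> k u v /cut_sub[_ yu _] /cut_sub[_ yv _]; apply: tet_clique yv.
- move=> k v cv; have [th yv pos] := cut_sub cv.
  have [u [uv yu same]] := tet_support yT yv.
  have id w : cut s y k w = y k w.
    by apply: cut_id; [exact: tet_le1|exact: theta_full (ltnSn k) th].
  exists u; split; rewrite ?id // => E; have := same E.
  by move: pos; move: (cut _ _ _ _) (y k.+1 v) (y k v) => a b c; nra.
- move=> j k u v jk cu /cut_sub[th yv _] uv; have [_ yu _] := cut_sub cu.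
  rewrite cut_id; [exact: tet_full jk yu yv uv|exact: tet_le1|exact: theta_full jk th].
- have [K yK] := tet_fin yT; exists K => k v Kk; apply/eqP; apply: contraT.
  by move=> /cut_sub[_]; rewrite yK ?eqxx.
Qed.

Lemma cut0 y : tetris y -> cut 0 y = y.
Proof.
move=> yT; apply/funext => k; apply/funext => v.
by apply: cut_id; [exact: tet_le1|exact: theta0].
Qed.

Lemma cut1 y : cut 1 y = @empty_tetris R V.
Proof.
apply/funext => k; apply/funext => v; apply/eqP; apply: contraT.
by move=> /cut_sub[]; rewrite theta1 eqxx.
Qed.

(** The inverse of [heap]; functions that are not heaps are sent to a preimage of the empty heap by
    default. *)
Definition unheap y : cover_space :=
  if pselect (exists e, heap e = y) is left h then projT1 (cid h)
  else projT1 (cid (heap_surj (empty_tetrisP R V))).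

Lemma unheapK y : tetris y -> heap (unheap y) = y.
Proof.
move=> yT; rewrite /unheap; case: pselect => [h|]; first exact: projT2 (cid h).
by case; apply: heap_surj.
Qed.

(** Continuity holds at time 0 as well, although infinitely many layers are affected arbitrarily
    soon after it: convergence is pointwise and each coordinate involves a single layer. *)
Lemma cover_contractible : contractible R cover_space.
Proof.
exists (unheap (@empty_tetris R V)), (fun p => unheap (cut p.2 (heap p.1))).
split.
- apply: continuous_subspaceT => -[e s]; apply: cover_cvg => k v.
  have -> : (fun p : cover_space * R => heap (unheap (cut p.2 (heap p.1))) k v) =
     (fun p => - theta k p.2) \max ((fun p => theta k p.2) \min (fun p => heap p.1 k v)).
    by apply/funext => p; rewrite unheapK; [|exact: cut_tetris (heap_tetris _)].
  have tc : {for (e, s), continuous (fun p : cover_space * R => theta k p.2)}.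
    by apply: continuous_comp; [exact: cvg_snd|exact: theta_continuous].
  apply: continuous_max; first by apply: continuousN.
  apply: continuous_min => //.
  apply: (@continuous_comp _ cover_space R fst (fun e => heap e k v)).
    exact: cvg_fst.
  exact: heap_continuous.
- move=> e /=; rewrite cut0; last exact: heap_tetris.
  by apply: heap_inj; rewrite unheapK //; apply: heap_tetris.
- by move=> e /=; rewrite cut1.
Qed.

End Contraction.

(** * The Salvetti complex *)

Lemma hausdorff_separated (R : realType) (X : topologicalType) :
  (forall x y : X, x <> y -> exists2 f : X -> R, continuous f & f x != f y) ->
  hausdorff_space X.
Proof.
move=> sep; rewrite open_hausdorff => x y /eqP/sep[f /continuousP fc fxy].
have := @Rhausdorff R; rewrite open_hausdorff => /(_ _ _ fxy)[[A B] /= [xA yB] [oA oB AB]].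
rewrite !inE in xA yB; exists (f @^-1` A, f @^-1` B); rewrite /= ?inE //.
split; [exact: fc|exact: fc|].
by rewrite -preimage_setI (eqP AB) preimage_set0.
Qed.

Section SalvettiSpace.
Variables (R : realType) (V : sgraph).
Implicit Types (u v : V) (k : nat) (t : V -> R).

Local Notation salvetti := (salvetti R V).
Local Notation cover_space := (cover_space R V).

Definition salvetti_space : Type := salvetti.
HB.instance Definition _ := Choice.on salvetti_space.

Definition cover_proj (e : cover_space) : salvetti_space := e.2.

Definition salvetti_open (U : set salvetti_space) := open (cover_proj @^-1` U).

Lemma salvetti_openT : salvetti_open setT.
Proof. by rewrite /salvetti_open preimage_setT; exact: openT. Qed.

Lemma salvetti_openI : setI_closed salvetti_open.
Proof. by move=> A B oA oB; rewrite /salvetti_open preimage_setI; exact: openI. Qed.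

Lemma salvetti_open_bigU (I : Type) (f : I -> set salvetti_space) :
  (forall i, salvetti_open (f i)) -> salvetti_open (\bigcup_i f i).
Proof.
by move=> fo; rewrite /salvetti_open preimage_bigcup; apply: bigcup_open => i _; apply: fo.
Qed.

HB.instance Definition _ := isOpenTopological.Build salvetti_space
  salvetti_openT salvetti_openI salvetti_open_bigU.

Lemma salvetti_openE (U : set salvetti_space) : open U <-> open (cover_proj @^-1` U).
Proof. by []. Qed.

Lemma cover_proj_continuous : continuous cover_proj.
Proof. by apply/continuousP => U /salvetti_openE. Qed.

Lemma salvetti_continuous (Z : topologicalType) (f : salvetti_space -> Z) :
  continuous (f \o cover_proj) -> continuous f.
Proof.
move=> /continuousP fc; apply/continuousP => U /fc.
by rewrite comp_preimage => /salvetti_openE.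
Qed.

(* A function of b v is continuous if it lifts to a continuous function on the
   interval ]-1, 1[ of the universal cover of the circle R/Z. *)
Lemma salvetti_coord_continuous (f : R -> R) (h : R -> R) v : continuous h ->
  (forall x, -1 < x < 1 -> f (if x < 0 then x + 1 else x) = h x) ->
  continuous (fun b : salvetti_space => f (val b v)).
Proof.
move=> hc fh; apply: salvetti_continuous => -[g b].
have [t [tc _ near_t]] := local_chart g b.
have near_f : \forall e \near ((g, b) : cover_space),
    ((fun b : salvetti_space => f (val b v)) \o cover_proj) e = h (t e v).
  by apply: filterS near_t => e [eE tC t1] /=; rewrite (chart eE tC t1).2 fh.
apply: continuous_near_eq near_f _.
by apply: (@continuous_comp cover_space R R (fun e => t e v) h); [exact: tc|exact: hc].
Qed.

(** On R/Z, the function x(1-x) determines x up to the symmetry exchanging x and 1-x, and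
    x(1-x)(1-2x) separates the two. The functions [c1] and [c2] are their lifts to ]-1, 1[. *)
Lemma salvetti_hausdorff : hausdorff_space salvetti_space.
Proof.
apply: (@hausdorff_separated R) => a b ab.
have [v abv] : exists v, val a v != val b v.
  apply: contra_notP ab => no; apply: salvetti_eq => v.
  by apply/eqP; apply: contraT => ab; case: no; exists v.
have c1 : continuous (fun x : R => `|x| * (1 - `|x|)).
  move=> x; apply: cvgM; first exact: norm_continuous.
  by apply: cvgB; [exact: cvg_cst|exact: norm_continuous].
have c2 : continuous (fun x : R => x * (1 - `|x|) * (1 - 2 * `|x|)).
  move=> x; apply: cvgM; first apply: cvgM; first exact: cvg_id.
    by apply: cvgB; [exact: cvg_cst|exact: norm_continuous].
  apply: cvgB; first exact: cvg_cst.
  by apply: cvgM; [exact: cvg_cst|exact: norm_continuous].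
have e1 (x : R) : -1 < x < 1 -> (fun y => y * (1 - y)) (if x < 0 then x + 1 else x) =
    `|x| * (1 - `|x|).
  by move=> _ /=; case: ltP => x0; [rewrite ltr0_norm //; ring|rewrite ger0_norm].
have e2 (x : R) : -1 < x < 1 ->
    (fun y => y * (1 - y) * (1 - 2 * y)) (if x < 0 then x + 1 else x) =
    x * (1 - `|x|) * (1 - 2 * `|x|).
  by move=> _ /=; case: ltP => x0; [rewrite ltr0_norm //; ring|rewrite ger0_norm].
have [E|] := eqVneq (val a v * (1 - val a v)) (val b v * (1 - val b v)); last first.
  by exists (fun b : salvetti_space => val b v * (1 - val b v)) => //;
    exact: (@salvetti_coord_continuous (fun y => y * (1 - y)) _ v c1 e1).
exists (fun b : salvetti_space => val b v * (1 - val b v) * (1 - 2 * val b v)).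
  exact: (@salvetti_coord_continuous (fun y => y * (1 - y) * (1 - 2 * y)) _ v c2 e2).
apply: contra abv => /eqP; rewrite E => E2.
have /andP[a0 a1] := salvetti01 a v; have /andP[b0 b1] := salvetti01 b v.
have [z|nz] := eqVneq (val b v * (1 - val b v)) 0.
  move: E; rewrite z => /eqP; rewrite mulf_eq0 subr_eq0 [1 == _]eq_sym (lt_eqF a1) orbF.
  move=> /eqP->.
  by move/eqP: z; rewrite mulf_eq0 subr_eq0 [1 == _]eq_sym (lt_eqF b1) orbF eq_sym.
have := mulfI nz E2; move: (val a v) (val b v) => x y xy.
by apply/eqP; lra.
Qed.

End SalvettiSpace.

Section RowNorm.
Variables (R : realType) (n : nat).
Implicit Type w : 'rV[R]_n.

Lemma row_norm_lt1 w : `|w| < 1 <-> forall i, `|w 0 i| < 1.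
Proof.
rewrite [`|w|]mx_normrE; split=> [/bigmax_ltP[_ w1] i|w1].
  exact: (w1 (0, i)).
by apply/bigmax_ltP; split=> // -[j i] _ /=; rewrite (ord1 j).
Qed.

Lemma row_norm_eq1 w : `|w| = 1 -> (exists i, `|w 0 i| = 1) /\ forall i, `|w 0 i| <= 1.
Proof.
move=> w1; split.
  have [|[j i] /=] := mx_norm_neq0 (x := w).
    by rewrite -[mx_norm w]/`|w| w1 oner_neq0.
  by rewrite -[mx_norm w]/`|w| w1 (ord1 j) => E; exists i.
move=> i; move: w1; rewrite [`|w|]mx_normrE => w1.
have : \big[Num.max/0]_ij `|w ij.1 ij.2| <= 1 by rewrite w1.
by move/bigmax_leP => [_ /(_ (0, i) isT)].
Qed.

End RowNorm.

(** * The cells of the Salvetti complex *)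

Section Cells.
Variables (R : realType) (V : sgraph).
Implicit Types (u v : V) (k : nat).

Local Notation salvetti := (salvetti R V).
Local Notation cover_space := (cover_space R V).
Local Notation salvetti_space := (salvetti_space R V).

Definition is_clique (s : {set V}) :=
  [forall u in s, forall v in s, noncomm u v ==> (u == v)].

Lemma is_cliqueP (s : {set V}) :
  reflect {in s &, forall u v, noncomm u v -> u = v} (is_clique s).
Proof.
apply: (iffP forall_inP) => [sc u v us vs uv|sc u us].
  by have /forall_inP/(_ v vs) := sc u us; rewrite uv => /eqP.
by apply/forall_inP => v vs; apply/implyP => uv; apply/eqP/sc.
Qed.

(** One cell for each clique; the empty clique gives the vertex. *)
Definition clique := {s : {set V} | is_clique s}.

Definition cell_dim (c : clique) : nat := #|val c|.

Implicit Type c : clique.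

(** Clamping extends the characteristic maps continuously to all row vectors and ensures that
    [cube_lift] is always a heap. *)
Definition clamp (x : R) : R := Num.max 0 (Num.min 1 x).

Lemma clamp_ge0 x : 0 <= clamp x. Proof. by rewrite le_max lexx. Qed.

Lemma clamp_le1 x : clamp x <= 1. Proof. by rewrite ge_max ler01 ge_min lexx. Qed.

Lemma clamp_id x : 0 <= x <= 1 -> clamp x = x.
Proof. by case/andP=> x0 x1; rewrite /clamp min_r // max_r. Qed.

Lemma clamp_continuous : continuous clamp.
Proof.
have -> : clamp = (fun=> 0) \max ((fun=> 1) \min id) by [].
move=> s; apply: continuous_max; first exact: cvg_cst.
by apply: continuous_min; [exact: cvg_cst|exact: cvg_id].
Qed.

Lemma clamp_half_continuous : continuous (fun x : R => clamp ((x + 1) / 2)).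
Proof.
move=> x; apply: (@continuous_comp R R R (fun x : R => (x + 1) / 2));
  last exact: clamp_continuous.
apply: cvgM; last exact: cvg_cst.
by apply: cvgD; [exact: cvg_id|exact: cvg_cst].
Qed.

(** The cube is lifted to the heaps with one layer and lengths in [0, 1]; the affine map takes
    [-1, 1] to [0, 1]. The sum has at most one term, since [enum_val] is injective. *)
Definition cube_lift c (w : 'rV[R]_(cell_dim c)) : nat -> V -> R := fun k v =>
  if k == 0%N then \sum_(i < cell_dim c | enum_val i == v) clamp ((w 0 i + 1) / 2)
  else 0.

Lemma cube_lift_enum c (w : 'rV[R]_(cell_dim c)) (i : 'I_(cell_dim c)) :
  cube_lift w 0%N (enum_val i) = clamp ((w 0 i + 1) / 2).
Proof.
rewrite /cube_lift /= (big_pred1 i) // => j.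
by rewrite /= (inj_eq enum_val_inj).
Qed.

Lemma cube_lift_out c (w : 'rV[R]_(cell_dim c)) k v : v \notin val c ->
  cube_lift w k v = 0.
Proof.
move=> vc; rewrite /cube_lift; case: eqP => // _; rewrite big_pred0 // => i.
by apply: contraNF vc => /eqP <-; apply: enum_valP.
Qed.

Lemma cube_lift_itv c (w : 'rV[R]_(cell_dim c)) k v : 0 <= cube_lift w k v <= 1.
Proof.
have [vc|vc] := boolP (v \in val c); last by rewrite cube_lift_out // lexx ler01.
case: k => [|k]; last by rewrite /cube_lift /= lexx ler01.
rewrite -(enum_rankK_in vc vc) cube_lift_enum.
by rewrite clamp_ge0 clamp_le1.
Qed.

Lemma cube_lift_tetris c (w : 'rV[R]_(cell_dim c)) : tetris (cube_lift w).
Proof.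
have supp k v : cube_lift w k v != 0 -> v \in val c.
  by move=> wv; apply: contraT => /(cube_lift_out w k) E; rewrite E eqxx in wv.
split.
- by move=> k v; have /andP[w0 w1] := cube_lift_itv w k v; rewrite ger0_norm.
- by move=> k u v /supp uc /supp vc; apply: (is_cliqueP _ (valP c)).
- by move=> k v; rewrite /cube_lift /= eqxx.
- by move=> j [|k] u v // _ _; rewrite /cube_lift /= eqxx.
- by exists 1%N => -[|k].
Qed.

Definition cell_map c (w : 'rV[R]_(cell_dim c)) : salvetti_space :=
  cover_proj (unheap (cube_lift w)).

Lemma cell_map_continuous c : continuous (@cell_map c).
Proof.
move=> w; apply: (@continuous_comp _ cover_space _ (fun w => unheap (cube_lift w))).
  apply: cover_cvg => k v.
  have -> : (fun w : 'rV[R]_(cell_dim c) => heap (unheap (cube_lift w)) k v) =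
            (fun w => cube_lift w k v).
    by apply/funext => z; rewrite unheapK //; apply: cube_lift_tetris.
  rewrite /cube_lift; case: (k == 0%N); last by apply: cst_continuous.
  under [X in {for _, continuous X}]funext do rewrite big_mkcond.
  apply: continuous_sum => i; case: (enum_val i == v); last by apply: cst_continuous.
  apply: (@continuous_comp 'rV[R]_(cell_dim c) R R (fun w => w 0 i)
    (fun x : R => clamp ((x + 1) / 2))).
    exact: coord_continuous.
  exact: clamp_half_continuous.
exact: cover_proj_continuous.
Qed.

(* The class of x in R/Z, for x in [0, 1]. *)
Definition wrap (x : R) := if x == 1 then 0 else x.

(** The coordinate of [v] is visible in the slot of [v]. If this is layer 0, a length 1 counts as a
    full letter and leaves 0. Otherwise the lift vanishes in the slot, so the coordinate is 0, and
    layer 0 has an integral length. *)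
Lemma cell_map_val c (w : 'rV[R]_(cell_dim c)) v :
  val (cell_map w) v = wrap (cube_lift w 0%N v).
Proof.
have E k : heap (unheap (cube_lift w)) k v = cube_lift w k v.
  by rewrite unheapK //; apply: cube_lift_tetris.
rewrite /cell_map /cover_proj; move: (unheap _) E => -[g b] E /=.
have := salvetti01 b v; have /andP[y0 y1] := cube_lift_itv w 0%N v.
have [slot0|slotN] := eqVneq (slot (tet R g) v true) 0%N.
  move: (E 0%N); rewrite heapE slot0 eqxx /= => <-.
  rewrite -(E 0%N) heapE slot0 eqxx /= in y0 y1; move=> /andP[b0 b1].
  rewrite /wrap; case: (tet_discrete R g 0%N v) y0 y1 => -> y0 y1.
  - by rewrite add0r ifN // lt_eqF.
  - by rewrite ifT; [lra|apply/eqP; lra].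
  - lra.
move: (E 0%N) (E (slot (tet R g) v true)); rewrite !heapE eqxx eq_sym.
rewrite (negbTE slotN) addr0 /=.
rewrite {2}/cube_lift (negbTE slotN) => E0 E1 /andP[b0 b1].
have -> : val b v = 0.
  by move: E1; case: (tet_discrete R g (slot (tet R g) v true) v) => ->; lra.
rewrite -E0 /wrap; rewrite -E0 in y0 y1.
case: (tet_discrete R g 0%N v) y0 y1 => -> y0 y1; rewrite ?eqxx //.
- by rewrite if_same.
- lra.
Qed.

Lemma cell_map_enum c (w : 'rV[R]_(cell_dim c)) i : `|w 0 i| < 1 ->
  val (cell_map w) (enum_val i) = (w 0 i + 1) / 2.
Proof.
rewrite ltr_norml => /andP[w1 w2]; rewrite cell_map_val cube_lift_enum clamp_id.
  by rewrite /wrap lt_eqF //; lra.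
by apply/andP; split; lra.
Qed.

Lemma cell_map_out c (w : 'rV[R]_(cell_dim c)) v : v \notin val c ->
  val (cell_map w) v = 0.
Proof.
by move=> vc; rewrite cell_map_val cube_lift_out // /wrap eq_sym oner_eq0.
Qed.

Lemma cell_map_support c (w : 'rV[R]_(cell_dim c)) v : `|w| < 1 ->
  (val (cell_map w) v != 0) = (v \in val c).
Proof.
move=> /row_norm_lt1 w1; have [vc|vc] := boolP (v \in val c); last first.
  by rewrite cell_map_out // eqxx.
rewrite -(enum_rankK_in vc vc) cell_map_enum //.
have := w1 (enum_rank_in vc v); rewrite ltr_norml => /andP[h _].
by rewrite gt_eqF //; lra.
Qed.

Lemma cell_map_cover (b : salvetti_space) :
  exists c, exists2 w : 'rV[R]_(cell_dim c), `|w| < 1 & cell_map w = b.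
Proof.
have sc : is_clique [set v | val b v != 0].
  by apply/is_cliqueP => u v; rewrite !inE => bu bv; exact: salvetti_clique bu bv.
pose c : clique := exist (fun s => is_clique s) _ sc.
pose w : 'rV[R]_(cell_dim c) := \row_i (2 * val b (enum_val i) - 1).
have w1 : `|w| < 1.
  apply/row_norm_lt1 => i; rewrite mxE ltr_norml.
  have /andP[b0 b1] := salvetti01 b (enum_val i).
  have bn : val b (enum_val i) != 0 by have := enum_valP i; rewrite inE.
  have {b0 bn} b0 : 0 < val b (enum_val i) by rewrite lt_neqAle eq_sym bn.
  by apply/andP; split; lra.
exists c, w => //; apply: salvetti_eq => v.
have [vc|vc] := boolP (v \in val c); last first.
  by rewrite cell_map_out //; move: vc; rewrite inE negbK => /eqP.
rewrite -(enum_rankK_in vc vc) cell_map_enum; last exact: (row_norm_lt1 w).1.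
by rewrite mxE; lra.
Qed.

Definition salvetti_CW : finite_CW R salvetti_space.
Proof.
apply: (@FiniteCW R salvetti_space clique cell_dim cell_map).
- exact: salvetti_hausdorff.
- by move=> c; apply: continuous_subspaceT; apply: cell_map_continuous.
- move=> c v w /row_norm_lt1 v1 /row_norm_lt1 w1 vw; apply/rowP => i.
  have := congr1 (fun b : salvetti => val b (enum_val i)) vw.
  by rewrite /= !cell_map_enum //; lra.
- move=> c d v w v1 w1 vw; apply/val_inj/setP => u.
  by rewrite -(cell_map_support u v1) vw cell_map_support.
- exact: cell_map_cover.
(* A coordinate equal to 1 or -1 becomes 0 in R/Z, so the support of a boundary point is a proper
   subset of the clique. *)
- move=> c v /row_norm_eq1[[i vi] v1].
  have [d [w w1 E]] := cell_map_cover (cell_map v).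
  exists d; last by exists w.
  apply: proper_card; apply/properP; split.
    apply/fintype.subsetP => u; rewrite -(cell_map_support u w1) E; apply: contraNT => uc.
    by rewrite cell_map_out.
  exists (enum_val i); first exact: enum_valP.
  rewrite -(cell_map_support _ w1) E negbK cell_map_val cube_lift_enum.
  move: vi; move/eqP; rewrite eqr_norml ler01 andbT => /orP[]/eqP->.
    have -> : (1 + 1) / 2 = 1 :> R by lra.
    by rewrite clamp_id ?lexx ?ler01 // /wrap eqxx.
  by rewrite addNr mul0r clamp_id ?lexx ?ler01 // /wrap if_same.
Qed.

Lemma raag_classifying (G : groupType) (j : {multiplicative G -> raag V}) :
  bijective j -> @classifying_space R G salvetti_space.
Proof.
case=> j' jK j'K.
exists cover_space, (fun g => translate (j g)), (@cover_proj R V); split.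
- exact: cover_contractible.
- split.
  + by move=> [x b]; rewrite /translate /= morph1 mul1g.
  + by move=> g h [x b]; rewrite /translate /= gmulfM mulgA.
  + by move=> g; apply: translate_continuous.
- move=> e; have [U [oU Ue Ufree]] := translate_covering e; exists U; split=> // g /Ufree jg.
  by apply: (can_inj jK); rewrite jg morph1.
- split=> [b|[x b] [x' b']]; first by exists (1%g, b).
  split=> [/= E|[g /= [_ ->]] //].
  exists (j' (x' / x)%g); rewrite j'K /translate /= mulgVK.
  by congr pair; rewrite -[b]/(cover_proj (x, b)) E.
- exact: salvetti_openE.
Qed.

End Cells.

Lemma raag_type_F (R : realType) (G : groupType) : is_raag G -> type_F R G.
Proof.
case=> V [j jbij]; exists (salvetti_space R V); split.
  exact: (inhabits (salvetti_CW R V)).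
exact: raag_classifying jbij.
Qed.

(** * Cones *)

Local Close Scope ring_scope.
Local Close Scope classical_set_scope.
Local Close Scope ring_scope.
Local Open Scope group_scope.

Section Morphisms.

Definition multiplicative_of (G H : groupType) (f : G -> H)
    (fM : {morph f : x y / x * y}) : {multiplicative G -> H} :=
  HB.pack f (isMultiplicative.Build G H f fM).

Lemma isomorphic_sym (G H : groupType) : isomorphic G H -> isomorphic H G.
Proof.
case=> f [g fK gK]; have gM : {morph g : x y / x * y}.
  by move=> x y; apply: (can_inj fK); rewrite gmulfM !gK.
by exists (multiplicative_of gM); exists f.
Qed.

Lemma isomorphic_trans (G H K : groupType) :
  isomorphic G H -> isomorphic H K -> isomorphic G K.
Proof.
by case=> f fb [g gb]; exists (g \o f : {multiplicative _ -> _}); apply: bij_comp.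
Qed.

Lemma inj_surj_bij (T U : Type) (f : T -> U) :
  injective f -> (forall y, exists x, f x = y) -> bijective f.
Proof.
move=> fI fS; exists (fun y => projT1 (cid (fS y))) => [x|y].
  by apply: fI; case: cid.
by case: cid.
Qed.

Lemma raag_lift (V : sgraph) (G : groupType) (f : V -> G) :
  (forall u v, adj u v -> commute (f u) (f v)) ->
  exists F : {multiplicative raag V -> G}, forall v, F (raag_gen v) = f v.
Proof.
move=> fC; have fR s t : raag_relation s t -> word_eval f s = word_eval f t.
  by case=> u v uv; rewrite /word_eval !big_cons big_nil /= !mulg1; apply: fC.
exists (multiplicative_of (pres_liftM fR)) => v; exact: pres_lift_gen.
Qed.

Lemma raag_commute (V : sgraph) (G : groupType) (f : {multiplicative raag V -> G}) x :
  (forall v, commute x (f (raag_gen v))) -> forall a, commute x (f a).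
Proof.
move=> xC; elim/raag_ind => [|a [v b] IH]; first by rewrite morph1; apply: commute1.
rewrite gmulfM; apply: commuteM => //; rewrite /letter; case: b => //=.
by rewrite morphV; apply: commuteV.
Qed.

End Morphisms.

Section IntegerPowers.
Variables (G : groupType) (g : G).

Definition zpow (n : Z_group) : G :=
  match (n : int) with Posz m => g ^+ m | Negz m => g ^- m.+1 end.

Lemma zpow_succ (n : int) : zpow (n + 1)%R = zpow n * g.
Proof.
case: n => [n|[|n]].
- by rewrite -PoszD addn1 /= /zpow expgSr.
- by rewrite /zpow /= expg1 mulVg.
- by rewrite /zpow /= [in RHS]expgS invgM mulgVK subn1.
Qed.

Lemma zpow_pred (n : int) : zpow (n - 1)%R = zpow n / g.
Proof. by rewrite -{2}(subrK 1%R n) zpow_succ mulgK. Qed.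

Lemma zpowM : {morph zpow : m n / m * n}.
Proof.
move=> m n; rewrite -[m * n]/((m : int) + (n : int))%R.
elim/int_ind: n => [|n IH|n IH].
- by rewrite addr0 /= mulg1.
- by rewrite -addn1 PoszD addrA !zpow_succ IH mulgA.
- by rewrite -addn1 PoszD opprD addrA !zpow_pred IH mulgA.
Qed.

Definition zpow_mor : {multiplicative Z_group -> G} := multiplicative_of zpowM.

Lemma zpow1 : zpow 1%:Z%R = g.
Proof. by []. Qed.

Lemma Z_morph_eq (f h : {multiplicative Z_group -> G}) :
  f 1%:Z%R = h 1%:Z%R -> f =1 h.
Proof.
move=> fh n; have fhV : f (- 1%:Z)%R = h (- 1%:Z)%R.
  have E (k : {multiplicative Z_group -> G}) : k (- 1%:Z)%R = (k 1%:Z%R)^-1.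
    by rewrite -morphV.
  by rewrite !E fh.
elim/int_ind: n => [|n IH|n IH].
- by rewrite -[0%R]/(1%g : Z_group) !morph1.
- rewrite -addn1 PoszD -[(_ + _)%R]/((n%:Z%R : Z_group) * (1%:Z%R : Z_group)).
  by rewrite !gmulfM IH fh.
- rewrite -addn1 PoszD opprD -[(_ + _)%R]/(((- n%:Z)%R : Z_group) * ((- 1%:Z)%R : Z_group)).
  by rewrite !gmulfM IH fhV.
Qed.

Lemma zpow_commute x n : commute x g -> commute x (zpow n).
Proof.
by move=> xg; case: n => n; [apply: commuteX|apply: commuteV; apply: commuteX].
Qed.

End IntegerPowers.

(** * The groups of the cones over a graph *)

Section ConeIsomorphisms.
Variable D : sgraph.

Let D1 := graph_join D (complete_graph 1).
Let D2 := graph_join D (complete_graph 2).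

(** The cone vertex commutes with all generators, so the universal properties of the factors yield
    two mutually inverse morphisms. *)
Lemma raag_cone : isomorphic (raag D1) (raag D * Z_group)%type.
Proof.
have [F FE] : exists F : {multiplicative raag D1 -> (raag D * Z_group)%type},
    forall v, F (raag_gen v) =
      match v with inl u => (raag_gen u, 1) | inr _ => (1, 1%:Z%R) end.
  apply: raag_lift => -[u|i] [v|j] //= uv.
  - by rewrite /commute -[LHS]/(_, _) -[RHS]/(_, _) /= (gen_commute uv) .
  - by rewrite /commute -[LHS]/(_, _) -[RHS]/(_, _) /= !mulg1 !mul1g.
  - by rewrite /commute -[LHS]/(_, _) -[RHS]/(_, _) /= !mulg1 !mul1g.
have [I IE] : exists I : {multiplicative raag D -> raag D1},
    forall v, I (raag_gen v) = raag_gen (inl v : D1).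
  by apply: raag_lift => u v uv; apply: gen_commute.
pose k := raag_gen (inr ord0 : D1).
have kC a n : commute (I a) (zpow k n).
  have kI b : commute k (I b).
    by apply: raag_commute => v; rewrite IE; apply: gen_commute.
  exact/zpow_commute/commute_sym.
pose g (p : (raag D * Z_group)%type) := I p.1 * zpow k p.2.
have gM : {morph g : p q / p * q}.
  move=> [a m] [b n]; rewrite /g /= gmulfM zpowM -!mulgA; congr (_ * _).
  by rewrite !mulgA kC.
exists F, g => [a|[a n]].
  have E := @raag_morph_eq D1 _ (multiplicative_of gM \o F : {multiplicative _ -> _})
    (idfun : {multiplicative _ -> _}).
  apply: E => -[u|i] /=; rewrite FE /g /=.
    by rewrite IE mulg1.
  by rewrite morph1 mul1g (ord1 i).
have F1 b : F (I b) = (b, 1).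
  pose inl_mor : raag D -> (raag D * Z_group)%type := fun x => (x, 1).
  have inlM : {morph inl_mor : x y / x * y}.
    by move=> x y; congr pair; rewrite mulg1.
  have E := @raag_morph_eq D _ (F \o I : {multiplicative _ -> _}) (multiplicative_of inlM).
  by apply: E => u /=; rewrite IE FE.
have F2 m : F (zpow k m) = (1, m).
  pose inr_mor : Z_group -> (raag D * Z_group)%type := fun x => (1, x).
  have inrM : {morph inr_mor : x y / x * y}.
    by move=> x y; congr pair; rewrite mulg1.
  have E := @Z_morph_eq _ (F \o zpow_mor k : {multiplicative _ -> _}) (multiplicative_of inrM).
  by apply: E => /=; rewrite FE.
by rewrite /g /= gmulfM F1 F2; congr pair; rewrite ?mulg1 ?mul1g.
Qed.

(** The cone vertex [x] is central and [chi x] is the generator of Z. [F] kills [x], [G] sends each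
    generator to its quotient by [x], and every [a] is the product of [G (F a)] and the power of [x]
    with exponent [chi a]. On the kernel of [chi] this power is trivial. *)
Lemma bestvina_brady_cone : isomorphic (bestvina_brady D2) (raag D1).
Proof.
pose x := raag_gen (inr ord_max : D2).
have xC b : commute x b.
  have := @raag_commute D2 _ (idfun : {multiplicative _ -> _}) x; apply => -[u|i] /=.
    exact: gen_commute.
  have [->|ix] := eqVneq i ord_max; first exact: commute_refl.
  by apply: gen_commute; rewrite /= /complete_adj eq_sym.
have [F FE] : exists F : {multiplicative raag D2 -> raag D1}, forall v, F (raag_gen v) =
    match v with inl u => raag_gen (inl u : D1)
               | inr i => if i == ord_max then 1 else raag_gen (inr ord0 : D1) end.
  apply: raag_lift => -[u|i] [v|j] uv.
  - exact: gen_commute.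
  - by case: eqP => _; [exact: commute1|exact: gen_commute].
  - by apply: commute_sym; case: eqP => _; [exact: commute1|exact: gen_commute].
  - case: eqP => _; first by apply: commute_sym; apply: commute1.
    by case: eqP => _; [exact: commute1|exact: commute_refl].
have divx_commute a b : commute a b -> commute (a / x) (b / x).
  move=> ab; apply: commuteM; apply: commute_sym; apply: commuteM.
  - exact: commute_sym.
  - by apply: commuteV; apply: commute_sym.
  - by apply: commute_sym; apply: commuteV; apply: commute_sym.
  - exact: commute_refl.
have [G GE] : exists G : {multiplicative raag D1 -> raag D2}, forall v, G (raag_gen v) =
    match v with inl u => raag_gen (inl u : D2)
               | inr _ => raag_gen (inr ord0 : D2) end / x.
  apply: raag_lift => -[u|i] [v|j] uv; apply: divx_commute.
  - exact: gen_commute.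
  - exact: gen_commute.
  - exact: gen_commute.
  - exact: commute_refl.
have FGK b : F (G b) = b.
  have E := @raag_morph_eq D1 _ (F \o G : {multiplicative _ -> _})
    (idfun : {multiplicative _ -> _}).
  apply: E => -[u|i] /=; rewrite GE gmulfM morphV !FE eqxx invg1 mulg1 //.
  by rewrite (ord1 i).
have chi_gmul (y z : raag D2) : chi (y / z) = chi y / chi z by rewrite gmulfM morphV.
have G_ker b : ker_pred (@chi D2) (G b).
  have triv_mor : {morph (fun _ : raag D1 => 1 : Z_group) : y z / y * z}.
    by move=> *; rewrite mulg1.
  have E := @raag_morph_eq D1 _ (@chi D2 \o G : {multiplicative _ -> _})
    (multiplicative_of triv_mor).
  apply/eqP; apply: E => v /=; rewrite GE chi_gmul.
  by case: v => *; rewrite !chi_gen mulgV.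
have GFE a : G (F a) * zpow x (chi a) = a.
  have gM : {morph (fun a => G (F a) * zpow x (chi a)) : y z / y * z}.
    move=> y z; rewrite !gmulfM zpowM -!mulgA; congr (_ * _).
    rewrite !mulgA; congr (_ * _).
    exact/zpow_commute/commute_sym.
  have E := @raag_morph_eq D2 _ (multiplicative_of gM) (idfun : {multiplicative _ -> _}).
  apply: E => v /=; rewrite chi_gen zpow1 FE; case: v => [u|i].
    by rewrite GE mulgVK.
  case: eqP => [->|/eqP ix]; first by rewrite morph1 mul1g.
  have -> : i = ord0 by apply: val_inj; case: i ix => -[|[|i]].
  by rewrite GE mulgVK.
pose h (b : raag D1) : bestvina_brady D2 := Sub (G b) (G_ker b).
have hK b : val (h b) = G b by [].
exists (F \o val : {multiplicative bestvina_brady D2 -> raag D1}), h => [a|b].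
  apply: val_inj; rewrite hK -[RHS]GFE (eqP (valP a)).
  by rewrite -[zpow x _]/(1 : raag D2) mulg1.
exact: FGK.
Qed.

(** Each cone vertex is adjacent to all other vertices, and at least one of the two survives the
    deletion of a vertex. *)
Lemma join_biconnected : (0 < #|D|)%N -> biconnected D2.
Proof.
move=> D0; have card2 : #|D2| = (#|D| + 2)%N.
  by rewrite card_sum [X in (_ + X)%N]card_ord.
have hub (i : 'I_2) (y : D2) : y != inr i -> adj (inr i : D2) y.
  by case: y => // j; apply: contra => /eqP ->.
split.
- by rewrite card2 addn2 !ltnS.
- split; first by rewrite card2 addn2.
  have step_up (y : D2) : connect (@adj D2) (inr ord0) y.
    by have [->|] := eqVneq y (inr ord0); [exact: connect0|move/hub/connect1].
  move=> y z; apply: connect_trans (step_up z).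
  by rewrite (sym_connect_sym (@adj_sym _)); exact: step_up.
- move=> v; have [i iv] : exists i : 'I_2, inr i != v :> D2.
    case: v => [u|j]; first by exists ord0.
    (* [rev_ord] exchanges the two cone vertices. *)
    by exists (rev_ord j); case: j => -[|[|j]].
  pose c : Defs.induced (predC1 v) := 
    exist (fun y : D2 => is_true (predC1 v y)) (inr i) iv.
  split; first by apply/card_gt0P; exists c.
  have step_up (y : Defs.induced (predC1 v)) : connect (@adj (Defs.induced (predC1 v))) c y.
    have [->|yc] := eqVneq y c; first exact: connect0.
    by apply: connect1; apply: hub; apply: contra yc => /eqP E; apply/eqP/val_inj.
  move=> y z; apply: connect_trans (step_up z).
  by rewrite (sym_connect_sym (@adj_sym _)); exact: step_up.
Qed.

End ConeIsomorphisms.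

(** * Automorphism groups *)

Section Automorphisms.

Lemma derived_morph (G H : groupType) (f : {multiplicative G -> H}) x :
  derived x -> derived (f x).
Proof.
elim=> [a b||a b _ da _ db|a _ da].
- by rewrite /commg !gmulfM !morphV; apply: derived_comm.
- by rewrite morph1; apply: derived_1.
- by rewrite gmulfM; apply: derived_mul.
- by rewrite morphV; apply: derived_inv.
Qed.

Lemma IAutP (G : groupType) (f : Aut G) :
  ker_pred (@H1_aut G) f <-> forall x, derived (x^-1 * f x).
Proof.
split=> [/eqP f1 x|fd].
  apply/(qproj_eq (commutator_subgroup G)).
  by rewrite -[RHS]/(H1_proj (f x)) -H1_funE -[H1_fun f]/(aut_fun (H1_aut f)) f1.
apply/eqP/autP => a; have [x ->] := H1_projP a.
by rewrite [LHS]H1_funE; apply/esym/(qproj_eq (commutator_subgroup G)).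
Qed.

(** One direction of the equivalence makes the induced map well defined, the other makes it
    injective. *)
Lemma Out_embedding (G H : groupType) (F : {multiplicative Aut G -> Aut H}) :
  (forall f, is_inner (F f) <-> is_inner f) ->
  exists Fout : {multiplicative Out G -> Out H}, injective Fout.
Proof.
move=> Finner; pose h (a : Out G) : Out H := @qproj _ (Inn H) (F (repr a)).
have hE f : h (@qproj _ (Inn G) f) = @qproj _ (Inn H) (F f).
  apply/qproj_eq; rewrite -morphV -gmulfM; apply/Finner.
  by apply/(qproj_eq (Inn G)); rewrite qproj_repr.
have hM : {morph h : a b / a * b}.
  move=> a b; rewrite -(qproj_repr a) -(qproj_repr b) -[_ * _](qprojM (Inn G)) !hE.
  by rewrite gmulfM [LHS](qprojM (Inn H)).
exists (multiplicative_of hM) => a b; rewrite /= -(qproj_repr a) -(qproj_repr b) !hE.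
move/qproj_eq; rewrite -morphV -gmulfM => /Finner ab.
exact/qproj_eq.
Qed.

Variables (G H : groupType).
Local Notation GZ := (G * Z_group)%type.
Variables (i : {multiplicative H -> GZ}) (j : GZ -> H).
Hypotheses (iK : cancel i j) (jK : cancel j i).

Lemma pairM (a b : G) (m n : Z_group) : ((a, m) * (b, n) : GZ) = (a * b, m * n).
Proof. by []. Qed.

Lemma jM : {morph j : x y / x * y}.
Proof. by move=> x y; apply: (can_inj iK); rewrite gmulfM !jK. Qed.

Definition extend_fun (f : G -> G) (x : H) : H := j (f (i x).1, (i x).2).

Lemma extend_morph (f : G -> G) : {morph f : x y / x * y} ->
  {morph extend_fun f : x y / x * y}.
Proof.
move=> fM x y; rewrite /extend_fun -jM pairM; congr j.
by rewrite gmulfM /= -fM.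
Qed.

Lemma extend_can (f g : G -> G) : cancel f g -> cancel (extend_fun f) (extend_fun g).
Proof.
by move=> fK x; rewrite /extend_fun jK /= fK -surjective_pairing iK.
Qed.

Definition extend (f : Aut G) : Aut H := MkAut (extend_morph (autM f))
  (extend_can (aut_funK f)) (extend_can (aut_invK f)).

Lemma extendE f a n : i (extend f (j (a, n))) = (f a, n).
Proof. by rewrite /= /extend_fun !jK. Qed.

Lemma extendM : {morph extend : f g / f * g}.
Proof. by move=> f g; apply: autP => x; rewrite /= /extend_fun jK. Qed.

Definition extend_mor : {multiplicative Aut G -> Aut H} := multiplicative_of extendM.

Lemma extend_inj : injective extend.
Proof.
move=> f g fg; apply: autP => a.
have := congr1 (fun h : Aut H => (i (h (j (a, 1)))).1) fg.
by rewrite /= /extend_fun !jK.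
Qed.

(** The factor Z is central, so conjugation by a pair is conjugation by its first component. *)
Lemma extend_inner f : is_inner (extend f) <-> is_inner f.
Proof.
split=> [[x fx]|[g fg]].
  exists (i x).1 => a; have := congr1 (fun y => (i y).1) (fx (j (a, 1))).
  by rewrite extendE !gmulfM morphV jK.
exists (j (g, 1)) => x; apply: (can_inj iK).
rewrite !gmulfM morphV /= /extend_fun !jK; case: (i x) => a n /=.
by rewrite fg; congr pair; rewrite /= mul1g mulg1.
Qed.

Lemma Z_commute (m n : Z_group) : commute m n.
Proof. exact: (@addrC int). Qed.

Lemma derived_Z (n : Z_group) : derived n -> n = 1.
Proof.
elim=> [x y||x y _ -> _ ->|x _ ->] //.
by apply/eqP/commgP; apply: Z_commute.
Qed.

Lemma derived_pair (p : GZ) : derived p -> derived p.1 /\ p.2 = 1.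
Proof.
have fstM : {morph (fun p : GZ => p.1) : x y / x * y} by [].
have sndM : {morph (fun p : GZ => p.2) : x y / x * y} by [].
move=> dp; split; first exact: (derived_morph (multiplicative_of fstM) dp).
exact: (derived_Z (derived_morph (multiplicative_of sndM) dp)).
Qed.

Lemma derived_inl (a : G) : derived a -> derived ((a, 1) : GZ).
Proof.
have inlM : {morph (fun a => (a, 1) : GZ) : x y / x * y}.
  by move=> x y; congr pair; rewrite mulg1.
exact: (derived_morph (multiplicative_of inlM)).
Qed.

Lemma extend_IAut (f : Aut G) : ker_pred (@H1_aut G) f -> ker_pred (@H1_aut H) (extend f).
Proof.
move=> /IAutP fd; apply/IAutP => x.
have -> : x^-1 * extend f x = multiplicative_of jM ((i x).1^-1 * f (i x).1, 1).
  apply: (can_inj iK); rewrite /= jK gmulfM morphV jK.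
  by case: (i x) => a n; congr pair; rewrite mulVg.
exact/derived_morph/derived_inl.
Qed.

Hypothesis central_derived_trivial :
  forall c : G, (forall x, commute c x) -> derived c -> c = 1.

(* An automorphism of G x Z in IAut fixes the generator z of Z, as it maps z to a
   central element of z [G, G], and preserves the projection to Z. *)
Lemma IAut_split (f : Aut H) : ker_pred (@H1_aut H) f ->
  forall a n, i (f (j (a, n))) = ((i (f (j (a, 1)))).1, n).
Proof.
move=> /IAutP fd.
have pd p : derived (p.1^-1 * (i (f (j p))).1) /\ (i (f (j p))).2 = p.2.
  have := derived_morph i (fd (j p)); rewrite gmulfM morphV jK => /derived_pair[d1 d2].
  by split=> //; apply/esym/(mulgI p.2^-1); rewrite mulVg -[LHS]d2.
move=> a n.
have -> : j (a, n) = j (a, 1) * j (1, n) by rewrite -jM pairM mulg1 mul1g.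
rewrite autM gmulfM [i (f (j (a, 1)))]surjective_pairing [i (f (j (1, n)))]surjective_pairing.
rewrite pairM !(pd _).2 /= mul1g; congr pair.
rewrite (@central_derived_trivial (i (f (j (1, n)))).1) ?mulg1 // => [x|].
  (* The element [j (1, n)] is central and [f] is onto, so the image of [j (1, n)] is central
     too. *)
  have E : commute (j (1, n)) (aut_inv f (j (x, 1))).
    rewrite -(iK (aut_inv f _)) /commute -!jM; case: (i _) => y m.
    by rewrite !pairM mulg1 mul1g [n * m]Z_commute.
  have := congr1 (fun y => (i (f y)).1) E; rewrite /= !autM aut_invK !gmulfM jK.
  by [].
by have := (pd (1, n)).1; rewrite invg1 mul1g.
Qed.

Lemma IAut_inv (f : Aut H) : ker_pred (@H1_aut H) f -> ker_pred (@H1_aut H) f^-1.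
Proof.
move=> /IAutP fd; apply/IAutP => x; have := derived_inv (fd (f^-1 x)).
by rewrite -[f (f^-1 x)]/(f (aut_inv f x)) aut_invK invgM invgK.
Qed.

(** By [IAut_split], [f] is determined by the map [r f] that it induces on [G]; the inverse of [f]
    also acts trivially on homology, and the map it induces is the inverse of [r f]. *)
Lemma IAut_extend (f : Aut H) : ker_pred (@H1_aut H) f ->
  exists2 g, ker_pred (@H1_aut G) g & extend g = f.
Proof.
move=> fI; have fs := IAut_split fI; have fs' := IAut_split (IAut_inv fI).
pose r (f : Aut H) a := (i (f (j (a, 1)))).1.
have rM h : {morph r h : x y / x * y}.
  move=> x y; rewrite /r -[(x * y, 1)]/((x * y, 1 * 1 : Z_group)) -pairM jM autM gmulfM.
  by [].
have rK (h h' : Aut H) : cancel h h' ->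
    (forall a n, i (h (j (a, n))) = ((i (h (j (a, 1)))).1, n)) ->
    cancel (r h) (r h').
  by move=> hK hs a; rewrite /r -hs iK hK jK.
pose g := MkAut (rM f) (rK f f^-1 (aut_funK f) fs) (rK f^-1 f (aut_invK f) fs').
exists g; last first.
  apply: autP => x; apply: (can_inj iK); rewrite /= /extend_fun jK /= -fs.
  by rewrite -surjective_pairing iK.
apply/IAutP => a; have /IAutP/(_ (j (a, 1)))/(derived_morph i) := fI.
by rewrite gmulfM morphV jK => /derived_pair[].
Qed.

Lemma IAut_isomorphic : isomorphic (IAut H) (IAut G).
Proof.
apply: isomorphic_sym.
pose h (f : IAut G) : IAut H := Sub (extend (val f)) (extend_IAut (valP f)).
have hE f : val (h f) = extend (val f) by [].
have hM : {morph h : f g / f * g}.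
  by move=> f g; apply: val_inj; rewrite valM !hE valM extendM.
exists (multiplicative_of hM); apply: inj_surj_bij => [f g|f] /=.
  by move=> /(congr1 val); rewrite !hE => /extend_inj/val_inj.
have [g gI gf] := IAut_extend (valP f).
exists (Sub g gI : IAut G); apply: val_inj; rewrite hE -gf; by [].
Qed.

End Automorphisms.

Theorem theorem15p11 (R : realType) (Delta : sgraph) (Delta_nonempty : (0 < #|Delta|)%N) :
  let Gamma := graph_join Delta (complete_graph 2) in
  let A := raag Delta in
  let H := bestvina_brady Gamma in
  [/\ biconnected Gamma,
      isomorphic H (A * Z_group)%type,
      is_raag H /\ type_F R H,
      (exists f : {multiplicative Aut A -> Aut H}, injective f) /\
      (exists f : {multiplicative Out A -> Out H}, injective f) &
      isomorphic (IAut H) (IAut A)].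
Proof.
move=> Gamma A H.
have HA1 := bestvina_brady_cone Delta.
have HP : isomorphic H (A * Z_group)%type := isomorphic_trans HA1 (raag_cone Delta).
have HR : is_raag H by exists (graph_join Delta (complete_graph 1)).
have [i [j iK jK]] := HP.
split; [exact: join_biconnected|exact: HP| | |].
- by split; last exact: raag_type_F.
- split; first by exists (extend_mor iK jK); apply: extend_inj.
  by apply: (@Out_embedding _ _ (extend_mor iK jK)); apply: extend_inner.
- apply: (IAut_isomorphic iK jK) => c cC.
  by apply: (central_derived R) => v; apply: cC.
Qed.
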